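(* Consider the stochastic Schrödinger equation on the sphere $i\partial_tu(t)=\Delta_{\mathbb S^2}u(t)+\dot L(t)$ with initial value $u_0$ and a (possibly complex-valued) mean-zero $Q$-Lévy process $L$ which is of trace class. Let $u_n^\kappa$ be the fully discrete approximation given by the forward Euler--Maruyama method with time step $\tau>0$. (i) If $u_0\in L^2(\mathbb S^2;\mathbb C)$, $0<\mathbb E[\mathcal M_0^\kappa-\mathcal M_0^{0,0}]<\infty$ and $\mathbb E[\mathcal M_0^{0,0}]<\infty$, then the expected mass of $u_n^\kappa$ grows exponentially fast in time: $$\mathbb E[\mathcal M_n^\kappa]\ge\exp\left(\tfrac12\tau t_n\right)\mathbb E\left[\mathcal M_0^\kappa-\mathcal M_0^{0,0}\right]$$ for every discrete time $t_n=n\tau$, $n\ge0$. (ii) If $u_0\in H^1(\mathbb S^2;\mathbb C)$, $0<\mathbb E[\mathcal E_0^\kappa-\mathcal E_0^{0,0}]<\infty$ and $\mathbb E[\mathcal E_0^{0,0}]<\infty$, then the expected energy of $u_n^\kappa$ grows exponentially fast in time: $$\mathbb E[\mathcal E_n^\kappa]\ge\exp\left(\tfrac12\tau t_n\right)\mathbb E\left[\mathcal E_0^\kappa-\mathcal E_0^{0,0}\right]$$ for every discrete time $t_n=n\tau$, $n\ge0$.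
   Context: $\mathbb S^2\subset\mathbb R^3$ is the unit sphere with its surface measure. $L^2(\mathbb S^2;\mathbb C)$ carries the Hermitian inner product $\langle f,g\rangle=\int_{\mathbb S^2}f\overline g\,dx$ and norm $\|\cdot\|$. $\Delta_{\mathbb S^2}$ is the Laplace--Beltrami operator and $\nabla_{\mathbb S^2}$ the surface gradient, viewed as $\mathbb C^3$-valued (tangential) vector field. The real spherical harmonics $Y_{\ell,m}$ ($\ell\ge0$, $-\ell\le m\le\ell$) form an orthonormal basis of $L^2(\mathbb S^2;\mathbb C)$ with $-\Delta_{\mathbb S^2}Y_{\ell,m}=\lambda_\ell Y_{\ell,m}$, $\lambda_\ell=\ell(\ell+1)$. $H^1(\mathbb S^2;\mathbb C)=(I-\Delta_{\mathbb S^2})^{-1/2}L^2(\mathbb S^2;\mathbb C)$. On a complete filtered probability space $(\Omega,\mathcal F,(\mathcal F_t)_{t\ge0},\mathbb P)$, $u_0$ is $\mathcal F_0$-measurable (possibly random) and $L$ is a square-integrable $L^2(\mathbb S^2;\mathbb C)$-valued Lévy process with respect to $(\mathcal F_t)$ (adapted, $L(0)=0$, stochastically continuous, stationary increments, $L(t)-L(s)$ independent of $\mathcal F_s$ for $s\le t$), with $\mathbb E[L(t)]=0$ and self-adjoint positive semi-definite covariance operator $Q$: $\mathbb E[\langle L(t),f\rangle\overline{\langle L(t),g\rangle}]=t\langle Qg,f\rangle$. ''Trace class'' means $\operatorname{Tr}(Q)=\sum_{\ell,m}\langle QY_{\ell,m},Y_{\ell,m}\rangle<\infty$. For an integer $\kappa>0$,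 $\mathcal P_\kappa$ is the orthogonal projection of $L^2(\mathbb S^2;\mathbb C)$ onto $H^\kappa=\operatorname{span}\{Y_{\ell,m}:0\le\ell\le\kappa,\,-\ell\le m\le\ell\}$; on vector-valued functions $\mathcal P_\kappa$ acts componentwise, i.e. $(\mathcal P_\kappa Z)_j=\sum_{\ell=0}^\kappa\sum_{m=-\ell}^\ell Z^j_{\ell,m}Y_{\ell,m}$ if $Z_j=\sum_{\ell=0}^\infty\sum_{m=-\ell}^\ell Z^j_{\ell,m}Y_{\ell,m}$. $\Delta^\kappa_{\mathbb S^2}$ is the restriction of $\Delta_{\mathbb S^2}$ to $H^\kappa$, and $\nabla^\kappa_{\mathbb S^2}=\mathcal P_\kappa\nabla_{\mathbb S^2}$ (acting on $H^\kappa$). With $t_n=n\tau$ and $\Delta L_n^\kappa=\mathcal P_\kappa(L(t_{n+1})-L(t_n))$, the forward Euler--Maruyama scheme is $u_{n+1}^\kappa=u_n^\kappa-i\tau\Delta^\kappa_{\mathbb S^2}u_n^\kappa-i\Delta L_n^\kappa$, $u_0^\kappa=\mathcal P_\kappa u_0$. Writing $u_n^\kappa=\sum_{\ell=0}^\kappa\sum_{m=-\ell}^\ell u_n^{\ell,m}Y_{\ell,m}$, the discrete mass and energy are $\mathcal M_n^\kappa=\|u_n^\kappa\|^2=\sum_{\ell,m}\mathcal M_n^{\ell,m}$ with $\mathcal M_n^{\ell,m}=|u_n^{\ell,m}|^2$, and $\mathcal E_n^\kappa=\|\nabla^\kappa_{\mathbb S^2}u_n^\kappa\|^2=\sum_{\ell,m}\mathcal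 E_n^{\ell,m}$ with $\mathcal E_n^{\ell,m}=\|\nabla^\kappa_{\mathbb S^2}(u_n^{\ell,m}Y_{\ell,m})\|^2$ (norms in $L^2(\mathbb S^2;\mathbb C^3)$).
   Formalization: The time step is restricted to 0 < τ ≤ 5/2 instead of any τ > 0: for larger steps the claim fails, e.g. κ = 1, L = 0, u_0 = Y_{1,0}, τ = 3 gives mass 1+4τ² = 37 at n = 1, below exp(τ²/2) ≈ 90. *)

(* Defs.v *)
From HB Require Import structures.
From mathcomp Require Import all_boot all_order all_algebra.
From mathcomp Require Import all_classical all_reals all_analysis.
From mathcomp Require Import measurable_realfun complex.
Import Order.TTheory GRing.Theory Num.Theory.
Import numFieldNormedType.Exports.

Set Implicit Arguments.
Unset Strict Implicit.
Unset Printing Implicit Defensive.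

Local Open Scope classical_set_scope.
Local Open Scope ring_scope.
Local Open Scope complex_scope.

Section Sphere.
Context (R : realType).

Definition sqnorm3 (x : 'rV[R]_3) : R := \sum_j x 0 j ^+ 2.

Definition sphere : Type := {x : 'rV[R]_3 | sqnorm3 x == 1}.

HB.instance Definition _ := Choice.on sphere.

Definition sph_coord (j : 'I_3) (x : sphere) : R := val x 0 j.

Definition polar_row (p : R * R) : 'rV[R]_3 :=
  \row_j [:: sin p.1 * cos p.2; sin p.1 * sin p.2; cos p.1]`_j.

Lemma polar_row_subproof p : sqnorm3 (polar_row p) == 1.
Proof.
rewrite /sqnorm3 !big_ord_recl big_ord0 !mxE/= addr0 !exprMn addrA -mulrDr.
by rewrite cos2Dsin2 mulr1 addrC cos2Dsin2.
Qed.

Definition polar (p : R * R) : sphere := Sub (polar_row p) (polar_row_subproof p).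

HB.instance Definition _ := isPointed.Build sphere (polar (0, 0)).

(* The sigma-algebra generated by the coordinates is the trace on the sphere
   of the Borel sets of R^3. *)
Definition coord_sets : set (set sphere) :=
  \bigcup_(j in [set: 'I_3]) preimage_set_system setT (sph_coord j) measurable.

Lemma sphere_measurableC A : <<s coord_sets >> A -> <<s coord_sets >> (~` A).
Proof. exact: sigma_algebraC. Qed.

HB.instance Definition _ := @isMeasurable.Build (coord_sets.-sigma)%mdisp sphere
  <<s coord_sets >> (@sigma_algebra0 _ setT coord_sets) sphere_measurableC
  (@sigma_algebra_bigcup _ setT coord_sets).

Lemma measurable_polar : measurable_fun [set: R * R] polar.
Proof.
apply: (@measurability _ _ _ _ _ _ coord_sets) => //.
move=> _ [_ [j _ [B mB <-]] <-]; rewrite !setTI.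
have msin : measurable_fun [set: R] (@sin R).
  by apply: continuous_measurable_fun; exact: continuous_sin.
have mcos : measurable_fun [set: R] (@cos R).
  by apply: continuous_measurable_fun; exact: continuous_cos.
suff mj : measurable_fun [set: R * R] (sph_coord j \o polar).
  by rewrite -comp_preimage -[X in measurable X]setTI; exact: mj.
rewrite /comp /sph_coord /=.
under eq_fun do rewrite mxE.
case: j => -[|[|[|//]]] ? /=.
- apply: measurable_funM; apply: measurableT_comp => //.
- apply: measurable_funM; apply: measurableT_comp => //.
- apply: measurableT_comp => //.
Qed.

(* dx = sin(theta) dtheta dphi for 0 <= theta <= pi and 0 <= phi <= 2 pi. *)
Definition surface_measure (A : set sphere) : \bar R :=
  (\int[lebesgue_measure \x lebesgue_measure]_(p in
     (`[0%R, pi] `*` `[0%R, (pi *+ 2)%R]) `&` polar @^-1` A) (sin p.1)%:E)%E.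

Lemma surface_measure0 : surface_measure set0 = 0%E.
Proof. by rewrite /surface_measure preimage_set0 setI0 integral_set0. Qed.

Lemma surface_measure_ge0 A : (0 <= surface_measure A)%E.
Proof.
apply: integral_ge0 => -[t p] [[/= + _] _].
by rewrite in_itv/= lee_fin => ?; exact: sin_ge0_pi.
Qed.

Lemma surface_measure_semi_sigma_additive : semi_sigma_additive surface_measure.
Proof.
move=> F mF tF mUF; rewrite /surface_measure preimage_bigcup setI_bigcupr.
rewrite ge0_integral_bigcup//.
- apply: is_cvg_ereal_nneg_natsum_cond => n _ _; exact: surface_measure_ge0.
- move=> k; apply: measurableI; first exact: measurableX.
  by rewrite -[X in measurable X]setTI; exact: measurable_polar.
- apply/measurable_EFinP; apply: measurable_funTS.
  apply: measurableT_comp => //.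
  by apply: continuous_measurable_fun; exact: continuous_sin.
- move=> -[t p] [k _ [[/= + _] _]].
  by rewrite in_itv/= lee_fin => ?; exact: sin_ge0_pi.
- apply/trivIsetP => i j _ _ ij; rewrite setIACA setIid -preimage_setI.
  by move/trivIsetP : tF => ->//; rewrite preimage_set0 setI0.
Qed.

HB.instance Definition _ := isMeasure.Build _ _ _ surface_measure
  surface_measure0 surface_measure_ge0 surface_measure_semi_sigma_additive.

End Sphere.

Section ComplexL2.
Context (R : realType).
Notation C := R[i].
Notation S2 := (sphere R).

Definition cintegral d (T : measurableType d) (mu : {measure set T -> \bar R})
    (f : T -> C) : C :=
  (\int[mu]_x complex.Re (f x)) +i* (\int[mu]_x complex.Im (f x)).

(* Elements of L^2(S^2; C) are represented by square-integrable functions, not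
   by classes: [inner], [norm2] and [L2_borel] do not distinguish functions that
   agree almost everywhere, and equalities in L^2 are stated as null distance. *)
Definition L2 (f : S2 -> C) : Prop :=
  [/\ measurable_fun [set: S2] (fun x => complex.Re (f x)),
      measurable_fun [set: S2] (fun x => complex.Im (f x)) &
      (\int[@surface_measure R]_x (Normc.normc (f x) ^+ 2)%:E < +oo)%E].

Definition inner (f g : S2 -> C) : C :=
  cintegral (@surface_measure R) (fun x => f x * (g x)^*).

Definition norm2 (f : S2 -> C) : R := Num.sqrt (complex.Re (inner f f)).

Definition dist2 (f g : S2 -> C) : R := norm2 (fun x => f x - g x).

(* Only the trace on [L2] of these sets of functions matters: they are the open
   and the Borel sets of the Hilbert space L^2(S^2; C). *)
Definition L2_open (O : set (S2 -> C)) : Prop :=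
  forall f, L2 f -> O f ->
    exists2 r : R, 0 < r & forall g, L2 g -> dist2 g f < r -> O g.

Definition L2_borel : set (set (S2 -> C)) := <<s L2_open >>.

Definition legendre (l : nat) : {poly R} :=
  (2 ^+ l * l`!%:R)^-1 *: (('X^2 - 1) ^+ l)^`(l).

(* In polar coordinates (x_1 + i x_2)^a = sin(theta)^a exp(i a phi), so that,
   with a = |m|, this is the usual normalisation of P_l^a(cos theta) times 1,
   sqrt(2) cos(a phi) or sqrt(2) sin(a phi) according to the sign of m. *)
Definition sph_harm (l : nat) (m : int) (x : S2) : R :=
  let a := `|m|%N in
  let z := (sph_coord 0 x +i* sph_coord 1 x) ^+ a in
  Num.sqrt ((l.*2.+1)%:R / (4 * pi) * ((l - a)`!%:R / (l + a)`!%:R)) *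
  ((legendre l)^`(a)).[sph_coord 2 x] *
  (if m == 0 then 1
   else Num.sqrt 2 * (if 0 < m then complex.Re z else complex.Im z)).

Definition Ylm (l : nat) (m : int) (x : S2) : C := (sph_harm l m x)%:C.

Definition deg_order (l : nat) (i : 'I_(l.*2.+1)) : int := (i : nat)%:Z - l%:Z.

Definition lambda (l : nat) : R := (l * l.+1)%:R.

Definition coef (f : S2 -> C) (l : nat) (m : int) : C := inner f (Ylm l m).

Definition mode (f : S2 -> C) (l : nat) (m : int) : S2 -> C :=
  fun x => coef f l m * Ylm l m x.

Definition sph_proj (kappa : nat) (f : S2 -> C) : S2 -> C :=
  fun x => \sum_(l < kappa.+1) \sum_(i < l.*2.+1) mode f l (deg_order i) x.

(* f = (I - Delta)^(-1/2) g for some g in L^2. *)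
Definition H1 (f : S2 -> C) : Prop :=
  L2 f /\ exists2 g, L2 g & forall l (i : 'I_(l.*2.+1)),
    coef f l (deg_order i) =
    ((Num.sqrt (1 + lambda l))^-1)%:C * coef g l (deg_order i).

(* [radial y] is y / |y| (for y != 0), so that g \o radial is the extension of
   g which is constant along rays. The surface gradient of g is the Euclidean
   gradient of that extension, and the Laplace-Beltrami operator is the surface
   divergence of the surface gradient. *)
Definition radial (y : 'rV[R]_3) : S2 :=
  insubd (point : S2) ((Num.sqrt (sqnorm3 y))^-1 *: y).

Definition rgrad (j : 'I_3) (g : S2 -> R) : S2 -> R :=
  fun x => 'D_(delta_mx 0 j) (g \o radial) (val x).

Definition grad (j : 'I_3) (f : S2 -> C) : S2 -> C :=
  fun x => rgrad j (fun y => complex.Re (f y)) x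
        +i* rgrad j (fun y => complex.Im (f y)) x.

Definition laplace_beltrami (f : S2 -> C) : S2 -> C :=
  fun x => \sum_(j < 3) grad j (grad j f) x.

Definition grad_proj (kappa : nat) (f : S2 -> C) (j : 'I_3) : S2 -> C :=
  sph_proj kappa (grad j f).

Definition vnorm2 (V : 'I_3 -> S2 -> C) : R :=
  Num.sqrt (\sum_(j < 3) norm2 (V j) ^+ 2).

Definition mass (f : S2 -> C) : R := norm2 f ^+ 2.

Definition mass_mode (f : S2 -> C) (l : nat) (m : int) : R :=
  Normc.normc (coef f l m) ^+ 2.

Definition energy (kappa : nat) (f : S2 -> C) : R :=
  vnorm2 (grad_proj kappa f) ^+ 2.

Definition energy_mode (kappa : nat) (f : S2 -> C) (l : nat) (m : int) : R :=
  vnorm2 (grad_proj kappa (mode f l m)) ^+ 2.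

Record covariance_operator (Q : (S2 -> C) -> (S2 -> C)) : Prop := {
  cov_L2 : forall f, L2 f -> L2 (Q f);
  cov_linear : forall (a : C) f g, L2 f -> L2 g ->
    dist2 (Q (fun x => a * f x + g x)) (fun x => a * Q f x + Q g x) = 0;
  cov_bounded : exists K : R, forall f, L2 f -> norm2 (Q f) <= K * norm2 f;
  cov_selfadjoint : forall f g, L2 f -> L2 g -> inner (Q f) g = inner f (Q g);
  cov_psd : forall f, L2 f -> 0 <= inner (Q f) f }.

Definition trace_class (Q : (S2 -> C) -> (S2 -> C)) : Prop :=
  (\sum_(0 <= l <oo) \sum_(i < l.*2.+1)
     (complex.Re (inner (Q (Ylm l (deg_order i))) (Ylm l (deg_order i))))%:E
   < +oo)%E.

End ComplexL2.

Section Stochastic.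
Context (R : realType) (d : measure_display) (Omega : measurableType d)
  (P : probability Omega R).
Notation C := R[i].
Notation S2 := (sphere R).

(* Times are the nonnegative reals. *)
Record complete_filtration (F : R -> set (set Omega)) : Prop := {
  filt_sigma : forall t : R, 0 <= t -> sigma_algebra setT (F t);
  filt_sub : forall t : R, 0 <= t -> F t `<=` measurable;
  filt_mono : forall s t : R, 0 <= s -> s <= t -> F s `<=` F t;
  filt_complete : P.-negligible `<=` F 0 }.

Definition L2_random (G : set (set Omega)) (X : Omega -> S2 -> C) : Prop :=
  (forall w, L2 (X w)) /\ (forall B, L2_borel B -> G (X @^-1` B)).

Definition increment (L : R -> Omega -> S2 -> C) (s t : R) :
    Omega -> S2 -> C :=
  fun w x => L t w x - L s w x.

(* The expectation of an L^2-valued variable is taken in the weak sense. *)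
Record levy_process (F : R -> set (set Omega)) (Q : (S2 -> C) -> (S2 -> C))
    (L : R -> Omega -> S2 -> C) : Prop := {
  levy_adapted : forall t : R, 0 <= t -> L2_random (F t) (L t);
  levy_init : {ae P, forall w, norm2 (L 0 w) = 0};
  levy_continuous : forall t e : R, 0 <= t -> 0 < e ->
    P [set w | e < norm2 (increment L t s w)]
      @[s --> within [set s | 0 <= s] (nbhs t)] --> 0%E;
  levy_stationary : forall (s t h : R) B, 0 <= s -> 0 <= t -> 0 <= h -> L2_borel B ->
    P (increment L s (s + h) @^-1` B) = P (increment L t (t + h) @^-1` B);
  levy_independent : forall (s t : R) A B, 0 <= s -> s <= t -> F s A -> L2_borel B ->
    P (A `&` increment L s t @^-1` B) = (P A * P (increment L s t @^-1` B))%E;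
  levy_square_integrable : forall t : R, 0 <= t ->
    ('E_P[fun w => (norm2 (L t w) ^+ 2)%R] < +oo)%E;
  levy_mean0 : forall (t : R) f, 0 <= t -> L2 f ->
    cintegral P (fun w => inner (L t w) f) = 0;
  levy_covariance : forall (t : R) f g, 0 <= t -> L2 f -> L2 g ->
    cintegral P (fun w => inner (L t w) f * (inner (L t w) g)^*) =
    t%:C * inner (Q g) f }.

Fixpoint euler_maruyama (L : R -> Omega -> S2 -> C) (u0 : Omega -> S2 -> C)
    (tau : R) (kappa n : nat) (w : Omega) : S2 -> C :=
  if n is k.+1 then
    let u := euler_maruyama L u0 tau kappa k w in
    let dL := sph_proj kappa (increment L (k%:R * tau) (k.+1%:R * tau) w) in
    fun x => u x - ('i)%C * tau%:C * laplace_beltrami u x - ('i)%C * dL x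
  else sph_proj kappa (u0 w).

End Stochastic.

(* Main.v *)
Require Import Defs.
From HB Require Import structures.
From mathcomp Require Import all_boot all_order all_algebra.
From mathcomp Require Import all_classical all_reals all_analysis.
From mathcomp Require Import measurable_realfun complex.
From mathcomp Require Import ring lra zify.
Import Order.TTheory GRing.Theory Num.Theory.
Import numFieldNormedType.Exports.

(** In the basis of spherical harmonics the deterministic part of one Euler step
multiplies a coefficient of degree [l] by [1 + i tau l(l+1)], whose squared
modulus [1 + (tau l(l+1))^2] is at least [1 + 4 tau^2] as soon as [l >= 1]. The
noise added by the step is centred and independent of the past, so it can only
increase a second moment ([integral_sq_add_noise]). Hence every quadratic form of
the coefficients which is a sum of squares of linear functionals, which does not
couple different degrees and which ignores degree 0 has an expectation that is
multiplied by at least [1 + 4 tau^2] at each step ([em_form_step]). Both the mass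
without its mode of degree 0 ([em_mass]) and the energy ([em_energy]) are such
forms, and [exp(tau^2 / 2) <= 1 + 4 tau^2] for [tau <= 5/2] ([expR_growth]). All
expectations are taken in [[0, +oo]] and the comparison is made by Tonelli's
theorem on the product law of the past and of the noise.

That the mass does not couple degrees is orthonormality. For the energy, the
gradient of a harmonic of degree [kappa] leaves [H^kappa], so that the projection
in the discrete gradient really acts. But among two distinct degrees one is smaller
than [kappa]; the components of the gradient of that harmonic are polynomials of
degree at most [kappa], fixed by the projection, which may therefore be dropped
from the mixed inner product. What is left is, by Green's formula ([sint_gdot]), a
multiple of the inner product of the two harmonics, which is 0 ([gradcoef_orth]).

The classical facts about spherical harmonics are derived from their explicit
formula. Restrictions of polynomials to the sphere form an algebra on which the
surface gradient is a derivation sending the coordinate [x_k] to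
[e_k - x_k x]; with the Legendre equation this gives the eigenvalues
([rlap_legendreZ]). Orthonormality is computed in polar coordinates
([sph_harm_orthonormal]). The span of the harmonics of degree at most [n] is
identified with the polynomials of degree at most [n] by a dimension count
([spol_harm_coef]); since the Laplacian of a harmonic has integral 0, so has the
Laplacian of every polynomial ([sint_rlap]), and this is all that Green's formula
needs. Real and imaginary parts are separated throughout, so that these facts are
only needed for real functions. *)

Set Implicit Arguments.
Unset Strict Implicit.
Unset Printing Implicit Defensive.

Local Open Scope classical_set_scope.
Local Open Scope ring_scope.
Local Open Scope complex_scope.

(** * Legendre polynomials *)

Section Legendre.
Context (R : realType).
Implicit Types (p q : {poly R}) (l k a : nat).

Lemma deriv_natr n : (n%:R : {poly R})^`() = 0.
Proof. by rewrite -polyC_natr derivC. Qed.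

Lemma deriv_weight n : ((1 - 'X^2 : {poly R}) ^+ n.+1)^`() =
  - (2 * n.+1%:R) * 'X * (1 - 'X^2) ^+ n.
Proof.
rewrite deriv_exp derivB derivC derivXn /= -mulr_natl expr1 -[_ *+ 2]mulr_natl.
ring.
Qed.

(** The case [k = 0] is the derivative of [(X^2 - 1) v' = 2 l X v]; each further
derivative raises [k] by one. Legendre's equation and all its derivatives are
instances. *)
Lemma rodrigues_ode l k :
  let v := ('X^2 - 1 : {poly R}) ^+ l in
  ('X^2 - 1) * v^`(k.+2) + (2 * k.+1%:R - 2 * l%:R) * 'X * v^`(k.+1) +
  (k%:R * k.+1%:R - 2 * l%:R * k.+1%:R) * v^`(k) = 0.
Proof.
move=> v.
have d1 : ('X^2 - 1) * v^`() = 2 * l%:R * 'X * v.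
  rewrite /v; case: l {v} => [|l].
    by rewrite expr0 derivC mulr0 mulr0 !mul0r.
  rewrite deriv_exp derivB derivC derivXn /= -mulr_natl expr1 -[_ *+ 2]mulr_natl.
  rewrite subr0 [(_ - _) ^+ l.+1]exprS; ring.
elim: k => [|k /(congr1 (@deriv R))].
  move/(congr1 (@deriv R)): d1; rewrite /derivn /=.
  rewrite !(derivM, derivB, derivXn, derivC, derivX, deriv_natr) /= ?expr1.
  move/eqP; rewrite -subr_eq0 => /eqP d1; rewrite -[RHS]d1; ring.
rewrite deriv0 !(derivM, derivD, derivN, derivB, derivXn, derivC, derivX, deriv_natr) /= ?expr1.
rewrite -!derivnS => <-; rewrite ?mulr0 ?mul0r; ring.
Qed.

Lemma legendreE l a : (legendre R l)^`(a) =
  (2 ^+ l * l`!%:R)^-1 *: (('X^2 - 1) ^+ l)^`(l + a).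
Proof. by rewrite /legendre derivnZ /derivn [in RHS]addnC iterD. Qed.

Lemma legendre_ode l a :
  let p := (legendre R l)^`(a) in
  (1 - 'X^2) * p^`()^`() - 2 * a.+1%:R * 'X * p^`()
   + (l%:R * l.+1%:R - a%:R * a.+1%:R) * p = 0.
Proof.
rewrite /= legendreE !derivZ -!derivnS -!scalerAr -!scalerBr -scalerDr.
move: (rodrigues_ode l (l + a)) => /= /eqP; rewrite -oppr_eq0 => /eqP E.
apply/eqP; rewrite scaler_eq0; apply/orP; right; apply/eqP; rewrite -[RHS]E.
rewrite -!natr1 !natrD; ring.
Qed.

(** Self-adjoint form of the equation of the associated Legendre functions; it
turns integration by parts into orthogonality and into a recursion for the norms. *)
Lemma legendre_sturm l a :
  let p := (legendre R l)^`(a) in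
  ((1 - 'X^2) ^+ a.+1 * p^`())^`() =
  - (l%:R * l.+1%:R - a%:R * a.+1%:R) * (1 - 'X^2) ^+ a * p.
Proof.
move=> p; rewrite derivM deriv_weight [_ ^+ a.+1]exprSr.
have /eqP := legendre_ode l a; rewrite -/p => /eqP E.
rewrite -[RHS]addr0 -[X in _ = _ + X](mulr0 ((1 - 'X^2) ^+ a)) -E; ring.
Qed.

Lemma size_rodrigues l : size (('X^2 - 1 : {poly R}) ^+ l) = (l.*2).+1.
Proof.
have s2 : size ('X^2 - 1 : {poly R}) = 3 by rewrite -polyC1 size_XnsubC.
rewrite polySpred ?expf_neq0// -?size_poly_gt0 ?s2// size_exp s2; lia.
Qed.

(** Start of the recursion for the norms: the last nonzero derivative. *)
Lemma legendre_top l : (legendre R l)^`(l) = ((l.*2)`!%:R / (2 ^+ l * l`!%:R))%:P.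
Proof.
rewrite legendreE addnn [_ / _]mulrC polyCM mul_polyC; congr (_ *: _).
apply/polyP => i; rewrite coef_derivn coefC.
case: i => [|i]; last first.
  by rewrite nth_default ?mul0rn// size_rodrigues; lia.
rewrite addn0 ffactnn /=.
have mon : ('X^2 - 1 : {poly R}) ^+ l \is monic.
  by apply: monic_exp; rewrite -polyC1 monicXnsubC.
by move/monicP: mon; rewrite lead_coefE size_rodrigues /= => ->.
Qed.

Section functional.
Variable (I : {poly R} -> R).
Hypothesis I_linear : forall (c : R) p q, I (c *: p + q) = c * I p + I q.
Hypothesis I_deriv : forall p, I p^`() = p.[1] - p.[-1].

Lemma functionalZ (c : R) p : I (c *: p) = c * I p.
Proof.
have I0 : I 0 = 0 by have := I_deriv 0; rewrite derivC => ->; rewrite !horner0 subrr.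
by have := I_linear c p 0; rewrite !addr0 I0 addr0.
Qed.

(** The weight vanishes at both ends of the interval, so integration by parts
against it has no boundary term. *)
Lemma functional_boundary0 a p : I ((1 - 'X^2) ^+ a.+1 * p)^`() = 0.
Proof. by rewrite I_deriv !hornerE /= !(expr2, mulrN1, opprK, mulr1, subrr, exprS, mul0r). Qed.

(** [legendre_sturm] for both factors: the Wronskian term integrates to 0, and
what remains is the integral times the difference of the eigenvalues. *)
Lemma assoc_legendre_orth l l' a : l != l' ->
  I ((1 - 'X^2) ^+ a * ((legendre R l)^`(a) * (legendre R l')^`(a))) = 0.
Proof.
move=> ll'; set p := _^`(a); set q := _^`(a).
have := functional_boundary0 a (p^`() * q - q^`() * p).
have -> : ((1 - 'X^2) ^+ a.+1 * (p^`() * q - q^`() * p))^`() =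
    (l'%:R * l'.+1%:R - l%:R * l.+1%:R : R) *: ((1 - 'X^2) ^+ a * (p * q)).
  rewrite mulrBr !mulrA derivB !(derivM _ p) !(derivM _ q).
  rewrite (legendre_sturm l a) (legendre_sturm l' a) -/p -/q.
  rewrite -mul_polyC polyCB !polyCM !polyC_natr; ring.
rewrite functionalZ => /eqP; rewrite mulf_eq0 => /orP[|/eqP//].
by rewrite subr_eq0 -!natrM eqr_nat => /eqP E; move: ll'; case: (ltngtP l l') => // ?; nia.
Qed.

Lemma assoc_legendre_norm_step l a :
  I ((1 - 'X^2) ^+ a.+1 * ((legendre R l)^`(a.+1)) ^+ 2) =
  (l%:R * l.+1%:R - a%:R * a.+1%:R) * I ((1 - 'X^2) ^+ a * ((legendre R l)^`(a)) ^+ 2).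
Proof.
set p := (legendre R l)^`(a).
have -> : (legendre R l)^`(a.+1) = p^`() by rewrite -derivnS.
rewrite -functionalZ; have := functional_boundary0 a (p^`() * p).
rewrite mulrA derivM (legendre_sturm l a) -/p => E.
rewrite -[RHS]add0r -[X in _ = X + _](mul1r 0) -E -I_linear scale1r; congr I.
rewrite -mul_polyC polyCB !polyCM !polyC_natr; ring.
Qed.

Lemma functional_weight l : I ((1 - 'X^2) ^+ l) = 2 * (2 ^+ l * l`!%:R) ^+ 2 / (l.*2.+1)`!%:R.
Proof.
elim: l => [|l IH].
  rewrite expr0 -(derivX R) I_deriv !hornerX !fact0 (_ : (0.*2.+1)`! = 1)%N //; by field.
have := functional_boundary0 l 'X.
rewrite derivM deriv_weight derivX.
have -> : - (2 * l.+1%:R) * 'X * (1 - 'X^2) ^+ l * 'X + (1 - 'X^2) ^+ l.+1 * 1 =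
   (- (2 * l.+1%:R) : R) *: (1 - 'X^2) ^+ l + ((2 * l.+1%:R + 1 : R) *: (1 - 'X^2) ^+ l.+1).
  rewrite -!mul_polyC polyCD polyCN !polyCM !polyC_natr polyC1 [_ ^+ l.+1]exprS; ring.
rewrite I_linear functionalZ {}IH => E.
have nz (n : nat) : n.+1%:R != 0 :> R by rewrite pnatr_eq0.
have nf (n : nat) : n`!%:R != 0 :> R by rewrite pnatr_eq0 -lt0n fact_gt0.
have c0 : 2 * l.+1%:R + 1 != 0 :> R by rewrite -(natrM _ 2%N) natr1.
apply: (mulfI c0).
move/eqP: E; rewrite addr_eq0 mulNr eqr_opp => /eqP <-.
rewrite doubleS !factS !natrM [2 ^+ l.+1]exprS.
have -> : l.*2.+3%:R = (2 * l.+1%:R + 1) :> R by rewrite -(natrM _ 2%N) natr1; congr (_%:R); lia.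
have -> : l.*2.+2%:R = (2 * l.+1%:R) :> R by rewrite -(natrM _ 2%N); congr (_%:R); lia.
by field; rewrite nf addrC natr1 nz addrC natr1 nz -(natrM _ 2%N) natr1 nz.
Qed.

(** Downward induction on [a] from [a = l], where the polynomial is constant and
the integral is [functional_weight]. *)
Lemma assoc_legendre_norm l a : (a <= l)%N ->
  I ((1 - 'X^2) ^+ a * ((legendre R l)^`(a)) ^+ 2) =
  2 / (l.*2.+1)%:R * ((l + a)`!%:R / (l - a)`!%:R).
Proof.
have nz (n : nat) : n.+1%:R != 0 :> R by rewrite pnatr_eq0.
have nf (n : nat) : n`!%:R != 0 :> R by rewrite pnatr_eq0 -lt0n fact_gt0.
elim: {a}(l - a)%N {-2}a (erefl (l - a)%N) => [a la al|k IH a la al].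
  have {al la}-> : a = l by lia.
  rewrite legendre_top -polyC_exp mulrC mul_polyC functionalZ functional_weight.
  rewrite subnn addnn factS natrM.
  by rewrite fact0; field; rewrite addrC natr1 nz !nf expf_neq0 ?pnatr_eq0.
have := assoc_legendre_norm_step l a; rewrite IH; [|lia..].
have -> : (l - a)%N = (l - a.+1).+1 by lia.
have -> : (l + a.+1)%N = (l + a).+1 by lia.
rewrite !factS !natrM.
have -> : l%:R * l.+1%:R - a%:R * a.+1%:R = (l - a.+1).+1%:R * (l + a).+1%:R :> R.
  rewrite -!natrM -natrB; last by nia.
  congr (_%:R); nia.
move=> E; apply: (mulfI (mulf_neq0 (nz (l - a.+1)%N) (nz (l + a)%N))).
rewrite -E.
move: (nz (l - a.+1)%N) (nz (l + a)%N) (nz l.*2) (nf (l - a.+1)%N) (nf (l + a)%N).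
move: (_.+1%:R) (_.+1%:R) (_.+1%:R) (_`!%:R) (_`!%:R) => x1 x2 x3 x4 x5 h1 h2 h3 h4 h5.
by field; rewrite ?h1 ?h2 ?h3 ?h4 ?h5.
Qed.
End functional.
End Legendre.

(** * The surface gradient as a derivation *)

Section SphereCalculus.
Context (R : realType).
Notation S2 := (sphere R).
Implicit Types (f g h : S2 -> R) (x : S2) (j k : 'I_3).

Lemma sphere_eq1 x : \sum_j sph_coord j x ^+ 2 = 1.
Proof. exact/eqP/(valP x). Qed.

Lemma val_radial (y : 'rV[R]_3) : 0 < sqnorm3 y ->
  val (radial y) = (Num.sqrt (sqnorm3 y))^-1 *: y.
Proof.
move=> y0; rewrite /radial insubdK//; apply/eqP.
rewrite /sqnorm3; under eq_bigr do rewrite mxE exprMn.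
by rewrite -mulr_sumr -/(sqnorm3 y) exprVn sqr_sqrtr ?ltW// mulVf ?gt_eqF.
Qed.

Lemma radial_val x : radial (val x) = x.
Proof.
have E : sqnorm3 (val x) = 1 by exact/eqP/(valP x).
by apply: val_inj; rewrite val_radial E ?ltr01// sqrtr1 invr1 scale1r.
Qed.

(** Directional derivatives at a point of the sphere only see this line, which
reduces the derivative of the radial projection to one variable. *)
Lemma sqnorm3_line x j (t : R) :
  sqnorm3 (t *: delta_mx 0 j + val x) = 1 + 2 * t * sph_coord j x + t ^+ 2.
Proof.
rewrite /sqnorm3.
transitivity (\sum_k (sph_coord k x ^+ 2 + (2 * t * sph_coord j x + t ^+ 2) * (j == k)%:R)).
  apply: eq_bigr => k _; rewrite !mxE eqxx/= eq_sym /sph_coord.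
  by have [->|_] := eqVneq j k; rewrite /=; ring.
rewrite big_split/= sphere_eq1 -mulr_sumr -addrA; congr (_ + _).
rewrite (bigD1 j)//= eqxx big1 ?addr0 ?mulr1// => i ij.
by rewrite eq_sym (negbTE ij).
Qed.

Lemma coord_radial_line x j k : \forall t \near (0 : R),
  sph_coord k (radial (t *: delta_mx 0 j + val x)) =
  (Num.sqrt (1 + 2 * t * sph_coord j x + t ^+ 2))^-1 *
  (t * (j == k)%:R + sph_coord k x).
Proof.
have pos : \forall t \near (0 : R), 0 < 1 + 2 * t * sph_coord j x + t ^+ 2.
  have : (fun t : R => 1 + 2 * t * sph_coord j x + t ^+ 2) @ (0 : R) -->
      (1 + 2 * 0 * sph_coord j x + 0 ^+ 2 : R).
    by apply: cvgD; [apply: cvgD; [exact: cvg_cst|apply: cvgM; [|exact: cvg_cst];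
      apply: cvgM; [exact: cvg_cst|exact: cvg_id]]|apply: cvgM; exact: cvg_id].
  rewrite mulr0 mul0r expr0n /= !addr0 => /cvgr_gt; apply; exact: ltr01.
apply: filterS pos => t t0.
rewrite [LHS]/sph_coord val_radial sqnorm3_line// !mxE eqxx /= eq_sym.
by rewrite eq_sym.
Qed.

(** Only derivatives along the axes at points of the sphere enter the surface
gradient, and this weak notion is stable under sums and products. *)
Definition smooth f := forall x j, derivable (f \o @radial R) (val x) (delta_mx 0 j).

(** The surface gradient of [x_k] is the projection of the basis vector [e_k] to
the tangent plane. *)
Lemma is_derive_coord x j k :
  is_derive (val x) (delta_mx 0 j) (sph_coord k \o @radial R)
    ((j == k)%:R - sph_coord j x * sph_coord k x).
Proof.
pose F (t : R) := (Num.sqrt (1 + 2 * t * sph_coord j x + t ^+ 2))^-1 *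
  (t * (j == k)%:R + sph_coord k x).
have dF : is_derive (0 : R) (1 : R) F ((j == k)%:R - sph_coord j x * sph_coord k x).
  have d1 : is_derive (0 : R) (1 : R) (fun t => 1 + 2 * t * sph_coord j x + t ^+ 2)
     (2 * sph_coord j x).
    by apply: is_derive_eq; rewrite /GRing.scale /=; ring.
  have d2 : is_derive (0 : R) (1 : R)
     (fun t => Num.sqrt (1 + 2 * t * sph_coord j x + t ^+ 2)) (sph_coord j x).
    pose u (t : R) := 1 + 2 * t * sph_coord j x + t ^+ 2.
    have u0 : u 0 = 1 by rewrite /u mulr0 mul0r expr0n /= !addr0.
    have ds : is_derive (u 0) (1 : R) (@Num.sqrt R) (2 * Num.sqrt (u 0))^-1.
      by apply: is_derive1_sqrt; rewrite u0.
    apply: (is_derive_eq (is_derive1_comp (f := @Num.sqrt R) (g := u) ds d1)).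
    by rewrite u0 sqrtr1 mulr1 mulKf.
  have s0 : Num.sqrt (1 + 2 * 0 * sph_coord j x + 0 ^+ 2 : R) = 1.
    by rewrite mulr0 mul0r expr0n /= !addr0 sqrtr1.
  have d3 : is_derive (0 : R) (1 : R)
     (fun t => (Num.sqrt (1 + 2 * t * sph_coord j x + t ^+ 2))^-1) (- sph_coord j x).
    have n0 : Num.sqrt (1 + 2 * 0 * sph_coord j x + 0 ^+ 2 : R) != 0 by rewrite s0 oner_eq0.
    pose r (t : R) := Num.sqrt (1 + 2 * t * sph_coord j x + t ^+ 2).
    have [d2d d2v] : is_derive (0 : R) (1 : R) r (sph_coord j x) := d2.
    split; first exact: (@derivableV _ _ r 0 1 n0 d2d).
    by rewrite (@deriveV _ _ r 0 1 n0 d2d) d2v /r s0 expr1n invr1 scaleN1r.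
  apply: is_derive_eq; rewrite s0 /GRing.scale /= invr1; ring.
have dG : is_derive (0 : R) (1 : R)
    (fun t => sph_coord k (radial (t *: delta_mx 0 j + val x)))
    ((j == k)%:R - sph_coord j x * sph_coord k x).
  apply: near_eq_is_derive dF; by apply: filterS (coord_radial_line x j k) => t ->.
split.
  by apply/derivable1P; case: dG.
case: dG => _ <-; rewrite /derive; congr (lim _).
by apply: congr2 => //; apply/funext => h /=; rewrite scale0r add0r addr0 [_%:A]mulr1.
Qed.

Lemma smooth_coord k : smooth (sph_coord k).
Proof. by move=> x j; have := is_derive_coord x j k => -[]. Qed.

Lemma rgrad_coord j k x :
  rgrad j (sph_coord k) x = (j == k)%:R - sph_coord j x * sph_coord k x.
Proof. by have := is_derive_coord x j k => -[_]. Qed.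

Lemma smooth_cst (c : R) : smooth (fun=> c).
Proof. by move=> x j; exact: derivable_cst. Qed.

Lemma rgrad_cst j (c : R) x : rgrad j (fun=> c) x = 0.
Proof. exact: derive_cst. Qed.

Lemma smoothD f g : smooth f -> smooth g -> smooth (fun x => f x + g x).
Proof. by move=> sf sg x j; exact: (derivableD (sf x j) (sg x j)). Qed.

Lemma rgradD j f g x : smooth f -> smooth g ->
  rgrad j (fun x => f x + g x) x = rgrad j f x + rgrad j g x.
Proof. by move=> sf sg; exact: (deriveD (sf x j) (sg x j)). Qed.

Lemma smoothM f g : smooth f -> smooth g -> smooth (fun x => f x * g x).
Proof. by move=> sf sg x j; exact: (derivableM (sf x j) (sg x j)). Qed.

Lemma rgradM j f g x : smooth f -> smooth g ->
  rgrad j (fun x => f x * g x) x = f x * rgrad j g x + g x * rgrad j f x.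
Proof.
move=> sf sg; have := deriveM (sf x j) (sg x j).
by rewrite /rgrad /= radial_val.
Qed.

End SphereCalculus.

(** * Polynomials on the sphere and their Laplacian *)

Section SpherePol.
Context (R : realType).
Notation S2 := (sphere R).
Implicit Types (f g h : S2 -> R) (x : S2) (j k : 'I_3).

(** Restrictions to the sphere of polynomials of degree at most [n]. The degree
is only an upper bound, since different polynomials may have the same
restriction. *)
Inductive spol : nat -> (S2 -> R) -> Prop :=
| spol_cst n c : spol n (fun=> c)
| spolD n f g : spol n f -> spol n g -> spol n (fun x => f x + g x)
| spolX n j f : spol n f -> spol n.+1 (fun x => sph_coord j x * f x).

Lemma spolS n f : spol n f -> spol n.+1 f.
Proof. by elim=> *; [exact: spol_cst|exact: spolD|exact: spolX]. Qed.

Lemma spol_le n m f : (n <= m)%N -> spol n f -> spol m f.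
Proof. by move=> /subnK <-; elim: (m - n)%N => //= k IH /IH; exact: spolS. Qed.

Lemma spolZ n (c : R) f : spol n f -> spol n (fun x => c * f x).
Proof.
elim=> {n f} [n d|n f g _ fc _ gc|n j f _ fc]; first exact: spol_cst.
- by under eq_fun do rewrite mulrDr; exact: spolD.
- by under eq_fun do rewrite mulrCA; exact: spolX.
Qed.

Lemma spolM n m f g : spol n f -> spol m g -> spol (n + m) (fun x => f x * g x).
Proof.
move=> + gm; elim=> {n f} [n c|n f h _ fc _ hc|n j f _ fc].
- by apply: spolZ; apply: spol_le gm; exact: leq_addl.
- by under eq_fun do rewrite mulrDl; exact: spolD.
- by under eq_fun do rewrite -mulrA; exact: spolX.
Qed.

Lemma spol_coord j : spol 1 (sph_coord j).
Proof.
rewrite (_ : sph_coord j = fun x => sph_coord j x * 1); last first.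
  by apply/funext => x; rewrite mulr1.
by apply: spolX; exact: (spol_cst 0).
Qed.

Lemma spolN n f : spol n f -> spol n (fun x => - f x).
Proof. by move=> fn; under eq_fun do rewrite -mulN1r; exact: spolZ. Qed.

Lemma spolB n f g : spol n f -> spol n g -> spol n (fun x => f x - g x).
Proof. by move=> fn gn; apply: spolD => //; exact: spolN. Qed.

Lemma spol_sum n (I : Type) (r : seq I) (P : pred I) (F : I -> S2 -> R) :
  (forall i, P i -> spol n (F i)) -> spol n (fun x => \sum_(i <- r | P i) F i x).
Proof.
move=> Fn; elim: r => [|i r IH].
  by under eq_fun do rewrite big_nil; exact: spol_cst.
under eq_fun do rewrite big_cons.
have := @Fn i; case: (P i) => // Fi.
by apply: spolD => //; exact: Fi.
Qed.

Lemma spol_smooth n f : spol n f -> smooth f.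
Proof.
elim=> *; [exact: smooth_cst|exact: smoothD|].
by apply: smoothM; [exact: smooth_coord|].
Qed.

Lemma rgrad_cstE j c : rgrad j (fun=> c : R) = fun=> 0.
Proof. by apply/funext => x; exact: rgrad_cst. Qed.

Lemma rgradDE n m j f g : spol n f -> spol m g ->
  rgrad j (fun x => f x + g x) = fun x => rgrad j f x + rgrad j g x.
Proof. by move=> /spol_smooth sf /spol_smooth sg; apply/funext => x; rewrite rgradD. Qed.

Lemma rgradME n m j f g : spol n f -> spol m g ->
  rgrad j (fun x => f x * g x) = fun x => f x * rgrad j g x + g x * rgrad j f x.
Proof. by move=> /spol_smooth sf /spol_smooth sg; apply/funext => x; rewrite rgradM. Qed.

Lemma rgrad_coordE j k : rgrad j (sph_coord k) =
  (fun x => (j == k)%:R - sph_coord j x * sph_coord k x).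
Proof. by apply/funext => x; rewrite rgrad_coord. Qed.

Lemma rgradZE n j (c : R) f : spol n f ->
  rgrad j (fun x => c * f x) = fun x => c * rgrad j f x.
Proof.
move=> fn; rewrite (rgradME j (spol_cst 0 c) fn).
by apply/funext => x; rewrite rgrad_cst mulr0 addr0.
Qed.

Lemma rgradNE n j f : spol n f -> rgrad j (fun x => - f x) = fun x => - rgrad j f x.
Proof.
move=> fn; under eq_fun do rewrite -mulN1r; rewrite (rgradZE _ _ fn).
by apply/funext => x; rewrite mulN1r.
Qed.

Lemma rgradBE n m j f g : spol n f -> spol m g ->
  rgrad j (fun x => f x - g x) = fun x => rgrad j f x - rgrad j g x.
Proof. by move=> fn gm; rewrite (rgradDE j fn (spolN gm)) (rgradNE j gm). Qed.

Lemma rgrad_sumE n j (I : Type) (r : seq I) (F : I -> S2 -> R) :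
  (forall i, spol n (F i)) ->
  rgrad j (fun x => \sum_(i <- r) F i x) = fun x => \sum_(i <- r) rgrad j (F i) x.
Proof.
move=> Fn; elim: r => [|i r IH].
  under eq_fun do rewrite big_nil; rewrite rgrad_cstE.
  by apply/funext => x; rewrite big_nil.
under eq_fun do rewrite big_cons.
rewrite (rgradDE _ (Fn i) (spol_sum r (fun i _ => Fn i))) IH.
by apply/funext => x; rewrite big_cons.
Qed.

(** The tangential part [x_k x] of the gradient of [x_k] is what raises the
degree by one. *)
Lemma spol_rgrad n j f : spol n f -> spol n.+1 (rgrad j f).
Proof.
elim=> {n f} [n c|n f g fn IHf gn IHg|n k f fn IH].
- by rewrite rgrad_cstE; exact: spol_cst.
- by rewrite (rgradDE j fn gn); exact: spolD.
- rewrite (rgradME j (spol_coord k) fn) rgrad_coordE.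
  apply: spolD; first exact: spolX.
  apply: (@spol_le (n + 2)); first by rewrite addn2.
  apply: spolM fn _; apply: spolB; first exact: spol_cst.
  exact: spolM (spol_coord j) (spol_coord k).
Qed.

Lemma sum_delta k (F : 'I_3 -> R) : \sum_j (j == k)%:R * F j = F k.
Proof.
rewrite (bigD1 k)//= eqxx mul1r big1 ?addr0// => j /negbTE ->; exact: mul0r.
Qed.

(** The radial extension is constant along rays. *)
Lemma rgrad_tangent n f x : spol n f -> \sum_j sph_coord j x * rgrad j f x = 0.
Proof.
elim=> {n f} [n c|n f g fn IHf gn IHg|n k f fn IH].
- by rewrite big1// => j _; rewrite rgrad_cst mulr0.
- under eq_bigr do rewrite (rgradDE _ fn gn) mulrDr.
  by rewrite big_split/= IHf IHg addr0.
- transitivity (sph_coord k x * (\sum_j sph_coord j x * rgrad j f x) +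
    f x * (\sum_j (j == k)%:R * sph_coord j x - sph_coord k x * \sum_j sph_coord j x ^+ 2)).
    rewrite mulrBr !mulr_sumr -sumrB -big_split/=; apply: eq_bigr => j _.
    by rewrite (rgradME j (spol_coord k) fn) rgrad_coord; ring.
  by rewrite IH sphere_eq1 sum_delta mulr1 subrr !mulr0 addr0.
Qed.

Definition gdot f g x : R := \sum_j rgrad j f x * rgrad j g x.
Definition rlap f x : R := \sum_j rgrad j (rgrad j f) x.

Lemma rlapM n m f g x : spol n f -> spol m g ->
  rlap (fun y => f y * g y) x = f x * rlap g x + g x * rlap f x + 2 * gdot f g x.
Proof.
move=> fn gm; rewrite /rlap /gdot !mulr_sumr -!big_split/=; apply: eq_bigr => j _.
have dfn := spol_rgrad j fn; have dgm := spol_rgrad j gm.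
rewrite (rgradME j fn gm) (rgradDE j (spolM fn dgm) (spolM gm dfn)).
rewrite (rgradME j fn dgm) (rgradME j gm dfn) /=.
move: (rgrad j (rgrad j f) x) (rgrad j (rgrad j g) x) (rgrad j f x) (rgrad j g x).
by move=> a b c e; ring.
Qed.

Lemma rlapZ n (c : R) f x : spol n f -> rlap (fun y => c * f y) x = c * rlap f x.
Proof.
move=> fn; rewrite /rlap mulr_sumr; apply: eq_bigr => j _.
by rewrite (rgradZE j c fn) (rgradZE j c (spol_rgrad j fn)).
Qed.

Lemma rlap_sum n (I : Type) (r : seq I) (F : I -> S2 -> R) x :
  (forall i, spol n (F i)) ->
  rlap (fun x => \sum_(i <- r) F i x) x = \sum_(i <- r) rlap (F i) x.
Proof.
move=> Fn; rewrite /rlap exchange_big; apply: eq_bigr => j _.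
by rewrite (rgrad_sumE j r Fn) (rgrad_sumE j r (fun i => spol_rgrad j (Fn i))).
Qed.

(** The projection to the tangent plane may be dropped against a tangent
vector. *)
Lemma gdot_coord n k f x : spol n f -> gdot (sph_coord k) f x = rgrad k f x.
Proof.
move=> fn; rewrite /gdot.
transitivity (\sum_j (j == k)%:R * rgrad j f x
  - sph_coord k x * \sum_j sph_coord j x * rgrad j f x).
  rewrite mulr_sumr -sumrB; apply: eq_bigr => j _.
  by rewrite rgrad_coord; ring.
by rewrite sum_delta (rgrad_tangent x fn) mulr0 subr0.
Qed.

(** The divergence of the unit normal field is 2, and the derivative of the radial
extension of [f] along the normal vanishes. *)
Lemma div_tangent n f x : spol n f ->
  \sum_j rgrad j (fun y => sph_coord j y * f y) x = 2 * f x.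
Proof.
move=> fn; transitivity (\sum_j sph_coord j x * rgrad j f x +
   f x * (3 - \sum_j sph_coord j x ^+ 2)).
  have -> : (3 : R) = \sum_(j < 3) 1 by rewrite sumr_const card_ord.
  rewrite -sumrB mulr_sumr -big_split/=; apply: eq_bigr => j _.
  by rewrite (rgradME j (spol_coord j) fn) rgrad_coord eqxx /=; ring.
by rewrite (rgrad_tangent x fn) sphere_eq1; ring.
Qed.

Lemma rlap_coord k x : rlap (sph_coord k) x = - 2 * sph_coord k x.
Proof.
rewrite mulNr -(div_tangent x (spol_coord k)) -sumrN; apply: eq_bigr => j _.
rewrite rgrad_coordE (rgradBE j (spol_cst 0 _) (spolM (spol_coord j) (spol_coord k))).
by rewrite rgrad_cst sub0r.
Qed.

Lemma spol_horner k (p : {poly R}) : spol (size p).-1 (fun x => p.[sph_coord k x]).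
Proof.
elim/poly_ind: p => [|p c IH].
  by under eq_fun do rewrite horner0; exact: spol_cst.
under eq_fun do rewrite hornerMXaddC.
have [->|p0] := eqVneq p 0.
  by under eq_fun do rewrite horner0 mul0r add0r; exact: spol_cst.
apply: spolD; last exact: spol_cst.
under eq_fun do rewrite mulrC.
rewrite size_MXaddC (negbTE p0) /= -(prednK (n := size p)) ?size_poly_gt0//.
exact: spolX.
Qed.

Lemma rgrad_horner j k (p : {poly R}) x : rgrad j (fun x => p.[sph_coord k x]) x =
  p^`().[sph_coord k x] * rgrad j (sph_coord k) x.
Proof.
elim/poly_ind: p => [|p c IH].
  by under eq_fun do rewrite horner0; rewrite rgrad_cst derivC horner0 mul0r.
under eq_fun do rewrite hornerMXaddC.
rewrite (rgradDE j (spolM (spol_horner k p) (spol_coord k)) (spol_cst 0 c)).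
rewrite (rgradME j (spol_horner k p) (spol_coord k)) IH rgrad_cst.
by rewrite derivMXaddC hornerD hornerM hornerX /=; ring.
Qed.

Lemma rgrad_hornerE j k (p : {poly R}) : rgrad j (fun x => p.[sph_coord k x]) =
  fun x => p^`().[sph_coord k x] * rgrad j (sph_coord k) x.
Proof. by apply/funext => x; exact: rgrad_horner. Qed.

Lemma rlap_horner k (p : {poly R}) x : rlap (fun x => p.[sph_coord k x]) x =
  (1 - sph_coord k x ^+ 2) * p^`()^`().[sph_coord k x]
  - 2 * sph_coord k x * p^`().[sph_coord k x].
Proof.
have -> : rlap (fun x => p.[sph_coord k x]) x =
  p^`().[sph_coord k x] * rlap (sph_coord k) x +
  gdot (sph_coord k) (fun x => p^`().[sph_coord k x]) x.
  rewrite /rlap /gdot mulr_sumr -big_split/=; apply: eq_bigr => j _.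
  rewrite rgrad_hornerE.
  by rewrite (rgradME j (spol_horner k _) (spol_rgrad j (spol_coord k))).
rewrite rlap_coord (gdot_coord _ _ (spol_horner k _)) rgrad_horner rgrad_coord eqxx /=.
ring.
Qed.

(** Real and imaginary parts of [(x_1 + i x_2)^a], the equatorial factor of a
spherical harmonic. *)
Definition reZ a x : R := complex.Re ((sph_coord 0 x +i* sph_coord 1 x) ^+ a).
Definition imZ a x : R := complex.Im ((sph_coord 0 x +i* sph_coord 1 x) ^+ a).

Lemma reZS a : reZ a.+1 = fun x => sph_coord 0 x * reZ a x - sph_coord 1 x * imZ a x.
Proof. by apply/funext => x; rewrite /reZ /imZ exprS; case: (_ ^+ a). Qed.

Lemma imZS a : imZ a.+1 = fun x => sph_coord 0 x * imZ a x + sph_coord 1 x * reZ a x.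
Proof. by apply/funext => x; rewrite /reZ /imZ exprS; case: (_ ^+ a). Qed.

Lemma spol_Z a : spol a (reZ a) /\ spol a (imZ a).
Proof.
elim: a => [|a [IHr IHi]]; first by split; exact: spol_cst.
rewrite reZS imZS; split.
- by apply: spolB; exact: spolX.
- by apply: spolD; exact: spolX.
Qed.
Let spol_re a := proj1 (spol_Z a).
Let spol_im a := proj2 (spol_Z a).

Lemma rgrad_Z0 j : rgrad j (reZ 0) = (fun=> 0) /\ rgrad j (imZ 0) = (fun=> 0).
Proof. by split; exact: rgrad_cstE. Qed.

(** Real form of the derivation rule
[grad zeta^(a+1) = (a+1) (zeta^a grad zeta)], where [zeta = x_1 + i x_2] is
homogeneous of degree 1, so that its tangential gradient is
[e_1 + i e_2 - zeta x]. *)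
Lemma rgrad_ZS j a :
  rgrad j (reZ a.+1) = (fun x => a.+1%:R * ((j == 0)%:R * reZ a x - (j == 1)%:R * imZ a x
    - sph_coord j x * reZ a.+1 x)) /\
  rgrad j (imZ a.+1) = (fun x => a.+1%:R * ((j == 0)%:R * imZ a x + (j == 1)%:R * reZ a x
    - sph_coord j x * imZ a.+1 x)).
Proof.
have prodZ b : rgrad j (reZ b.+1) = (fun x =>
      sph_coord 0 x * rgrad j (reZ b) x + reZ b x * ((j == 0)%:R - sph_coord j x * sph_coord 0 x)
    - (sph_coord 1 x * rgrad j (imZ b) x + imZ b x * ((j == 1)%:R - sph_coord j x * sph_coord 1 x)))
  /\ rgrad j (imZ b.+1) = (fun x =>
      sph_coord 0 x * rgrad j (imZ b) x + imZ b x * ((j == 0)%:R - sph_coord j x * sph_coord 0 x)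
    + (sph_coord 1 x * rgrad j (reZ b) x
       + reZ b x * ((j == 1)%:R - sph_coord j x * sph_coord 1 x))).
  rewrite (reZS b) (imZS b).
  rewrite (rgradBE j (spolX 0 (spol_re b)) (spolX 1 (spol_im b))).
  rewrite (rgradDE j (spolX 0 (spol_im b)) (spolX 1 (spol_re b))).
  rewrite !(rgradME j (spol_coord _) (spol_re b)) !(rgradME j (spol_coord _) (spol_im b)).
  by rewrite !rgrad_coordE.
elim: a => [|a [IHr IHi]].
  have [-> ->] := prodZ 0%N; have [-> ->] := rgrad_Z0 j.
  by rewrite reZS imZS; split; apply/funext => x; rewrite /reZ /imZ /=; ring.
have [-> ->] := prodZ a.+1; rewrite IHr IHi.
by rewrite (reZS a.+1) (imZS a.+1) (reZS a) (imZS a); split; apply/funext => x; ring.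
Qed.

(** [zeta^a] is harmonic and homogeneous of degree [a] in space. *)
Lemma rlap_Z a x :
  rlap (reZ a) x = - (a%:R * a.+1%:R) * reZ a x /\
  rlap (imZ a) x = - (a%:R * a.+1%:R) * imZ a x.
Proof.
case: a => [|a].
  rewrite mul0r oppr0 !mul0r /rlap; split; apply: big1 => j _.
    by rewrite (proj1 (rgrad_Z0 j)) rgrad_cst.
  by rewrite (proj2 (rgrad_Z0 j)) rgrad_cst.
have E (c d : R) f g h n k l : spol n f -> spol n g -> spol n h ->
    \sum_j rgrad j (fun x => d * ((j == k)%:R * f x + c * ((j == l)%:R * g x)
       - sph_coord j x * h x)) x =
    d * (rgrad k f x + c * rgrad l g x - 2 * h x).
  move=> fn gn hn; rewrite -(div_tangent x hn).
  rewrite -(sum_delta k (fun j => rgrad j f x)) -(sum_delta l (fun j => rgrad j g x)).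
  rewrite !mulr_sumr -big_split/= -sumrB mulr_sumr; apply: eq_bigr => j _.
  have f1 := spolZ (j == k)%:R fn.
  have g1 := spolZ (j == l)%:R gn; have g2 := spolZ c g1.
  have h1 := spolX j hn; have fg := spolD f1 g2.
  rewrite (rgradZE j d (spolB (spolS fg) h1)) (rgradBE j fg h1) (rgradDE j f1 g2).
  by rewrite (rgradZE j _ fn) (rgradZE j c g1) (rgradZE j _ gn).
have re_le := spolS (spol_re a); have im_le := spolS (spol_im a).
have reE : rlap (reZ a.+1) x =
    a.+1%:R * (rgrad 0 (reZ a) x + (-1) * rgrad 1 (imZ a) x - 2 * reZ a.+1 x).
  rewrite -(E _ _ _ _ _ _ _ _ re_le im_le (spol_re a.+1)); apply: eq_bigr => j _.
  by rewrite (proj1 (rgrad_ZS j a)); congr (rgrad j _ x); apply/funext => y; rewrite mulN1r.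
have imE : rlap (imZ a.+1) x =
    a.+1%:R * (rgrad 0 (imZ a) x + 1 * rgrad 1 (reZ a) x - 2 * imZ a.+1 x).
  rewrite -(E _ _ _ _ _ _ _ _ im_le re_le (spol_im a.+1)); apply: eq_bigr => j _.
  by rewrite (proj2 (rgrad_ZS j a)); congr (rgrad j _ x); apply/funext => y; rewrite mul1r.
rewrite {}reE {}imE; case: a re_le im_le => [|a] _ _.
  rewrite (proj1 (rgrad_Z0 0)) (proj1 (rgrad_Z0 1)) (proj2 (rgrad_Z0 0)) (proj2 (rgrad_Z0 1)).
  by split; ring.
rewrite (proj1 (rgrad_ZS 0 a)) (proj1 (rgrad_ZS 1 a)) (proj2 (rgrad_ZS 0 a)) (proj2 (rgrad_ZS 1 a)).
by rewrite !eqxx (reZS a.+1) (imZS a.+1) /=; split; ring.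
Qed.

Lemma rgrad2_Z a x :
  rgrad 2 (reZ a) x = - a%:R * sph_coord 2 x * reZ a x /\
  rgrad 2 (imZ a) x = - a%:R * sph_coord 2 x * imZ a x.
Proof.
case: a => [|a].
  rewrite (proj1 (rgrad_Z0 2)) (proj2 (rgrad_Z0 2)); split; ring.
rewrite (proj1 (rgrad_ZS 2 a)) (proj2 (rgrad_ZS 2 a)) /=; split; ring.
Qed.

(** The product rule gives
[zeta^a ((1 - z^2) p'' - 2 (a+1) z p' - a (a+1) p)] with [z = x_3], which the
differential equation [legendre_ode] simplifies. *)
Lemma rlap_legendreZ l a x :
  let p := (legendre R l)^`(a) in
  rlap (fun y => p.[sph_coord 2 y] * reZ a y) x =
    - lambda R l * (p.[sph_coord 2 x] * reZ a x) /\
  rlap (fun y => p.[sph_coord 2 y] * imZ a y) x =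
    - lambda R l * (p.[sph_coord 2 x] * imZ a x).
Proof.
move=> p; have sp := spol_horner 2 p.
have G f : gdot (fun y => p.[sph_coord 2 y]) f x = p^`().[sph_coord 2 x] * gdot (sph_coord 2) f x.
  by rewrite /gdot mulr_sumr; apply: eq_bigr => j _; rewrite rgrad_horner mulrA.
rewrite (rlapM x sp (spol_re a)) (rlapM x sp (spol_im a)) !G.
rewrite (gdot_coord 2 x (spol_re a)) (gdot_coord 2 x (spol_im a)).
have [-> ->] := rgrad2_Z a x; have [-> ->] := rlap_Z a x.
rewrite !rlap_horner /lambda natrM.
have /(congr1 (horner^~ (sph_coord 2 x))) := legendre_ode R l a.
rewrite -/p !(hornerE, hornerMn) /= => E.
by split; apply/eqP; rewrite -subr_eq0; apply/eqP;
  [rewrite -[RHS](mulr0 (reZ a x))|rewrite -[RHS](mulr0 (imZ a x))]; rewrite -E; ring.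
Qed.

End SpherePol.

(** * Integration in polar coordinates *)

Section WeightedImage.
Context d1 d2 (X : measurableType d1) (Y : measurableType d2) (R : realType).
Variables (mu : {measure set X -> \bar R}) (nu : {measure set Y -> \bar R}).
Variables (h : X -> Y) (D : set X) (w : X -> R).
Hypotheses (mh : measurable_fun setT h) (mD : measurable D)
  (mw : measurable_fun D w) (w0 : forall x, D x -> 0 <= w x).
Hypothesis nuE : forall A, measurable A ->
  nu A = (\int[mu]_(x in D `&` h @^-1` A) (w x)%:E)%E.
Local Open Scope ereal_scope.

Let integral_weighted_indic A : measurable A ->
  \int[nu]_y (\1_A y)%:E = \int[mu]_(x in D) ((\1_A (h x))%:E * (w x)%:E).
Proof.
move=> mA; rewrite integral_indic//= setIT nuE// integral_mkcondr.
apply: eq_integral => x _; rewrite patchE indicE.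
have -> : (x \in h @^-1` A) = (h x \in A) by apply/idP/idP; rewrite !inE.
by case: ifPn; rewrite ?mul1e ?mul0e.
Qed.

Import HBNNSimple.

Let integral_weighted_nnsfun (f : {nnsfun Y >-> R}) :
  \int[nu]_y (f y)%:E = \int[mu]_(x in D) ((f (h x))%:E * (w x)%:E).
Proof.
under [LHS]eq_integral do rewrite fimfunE -fsumEFin//.
rewrite [LHS]ge0_integral_fsum//; last 2 first.
  - by move=> r; exact/measurable_EFinP/measurableT_comp.
  - by move=> n x _; rewrite EFinM nnfun_muleindic_ge0.
under [RHS]eq_integral.
  move=> x xD; rewrite fimfunE -fsumEFin// ge0_mule_fsuml; last first.
    by move=> r; rewrite EFinM nnfun_muleindic_ge0.
  over.
have mindic r : measurable_fun D (fun x => (\1_(f @^-1` [set r]) (h x))%:E).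
  apply/measurable_EFinP; apply: measurable_funTS.
  exact: measurableT_comp.
rewrite [RHS]ge0_integral_fsum//; last 2 first.
  - move=> r; under eq_fun do rewrite EFinM.
    apply: emeasurable_funM; last exact/measurable_EFinP.
    apply: emeasurable_funM => //.
  - move=> n x Dx; rewrite EFinM mule_ge0//; last by rewrite lee_fin w0.
    by rewrite nnfun_muleindic_ge0.
apply: eq_fsbigr => r _; rewrite integralZl_indic_nnsfun//=.
have [r0|r0] := leP 0%R r; last first.
  have e : f @^-1` [set r] = set0.
    by apply/seteqP; split => // y /= fy; move: r0; rewrite -fy ltNge fun_ge0.
  rewrite e integral_indic//= set0I measure0 mule0 integral0_eq// => x _.
  by rewrite indicE in_set0 mulr0 mul0e.
under [RHS]eq_integral do rewrite EFinM -muleA.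
rewrite ge0_integralZl//.
- by rewrite integral_weighted_indic.
- by apply: emeasurable_funM => //; exact/measurable_EFinP.
- by move=> x Dx; rewrite mule_ge0// lee_fin w0.
Qed.

(** If [nu] is the image under [h] of the measure with density [w] on [D], then
so are the integrals: true for indicators by hypothesis, hence for simple functions
and for their monotone limits. *)
Lemma ge0_integral_weighted_image (f : Y -> \bar R) :
  measurable_fun setT f -> (forall y, 0 <= f y) ->
  \int[nu]_y f y = \int[mu]_(x in D) (f (h x) * (w x)%:E).
Proof.
move=> mf f0.
pose f_ := nnsfun_approx measurableT mf.
transitivity (lim (\int[nu]_x (f_ n x)%:E @[n --> \oo])).
  rewrite -monotone_convergence//=.
  - apply: eq_integral => ? /[!inE] xD; apply/esym/cvg_lim => //=.
    exact: cvg_nnsfun_approx.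
  - by move=> n; exact/measurable_EFinP/measurable_funTS.
  - by move=> n ? _; rewrite lee_fin.
  - by move=> ? _ ? ? mn; rewrite lee_fin; exact/lefP/nd_nnsfun_approx.
transitivity (lim (\int[mu]_(x in D) ((f_ n (h x))%:E * (w x)%:E) @[n --> \oo])).
  by apply: congr_lim; apply/funext => n /=; exact: integral_weighted_nnsfun.
rewrite -monotone_convergence//=.
- apply: eq_integral => x /[!inE] xD; apply/cvg_lim => //=.
  apply: cvgeZr => //.
  exact: cvg_nnsfun_approx.
- move=> n; apply: emeasurable_funM; last exact/measurable_EFinP.
  by apply/measurable_EFinP; apply: measurable_funTS; exact: measurableT_comp.
- by move=> n x Dx; rewrite mule_ge0// lee_fin ?w0.
- move=> x Dx m n mn; rewrite lee_wpmul2r ?lee_fin ?w0//.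
  exact/lefP/nd_nnsfun_approx.
Qed.

(** The weight is nonnegative, so it commutes with positive and negative
parts. *)
Lemma integral_weighted_image (f : Y -> R) : measurable_fun setT f ->
  \int[nu]_y (f y)%:E = \int[mu]_(x in D) (f (h x) * w x)%:E.
Proof.
move=> mf; rewrite [LHS]integralE [RHS]integralE.
have mfE : measurable_fun setT (EFin \o f) by exact/measurable_EFinP.
rewrite !ge0_integral_weighted_image//; first congr (_ - _).
- apply: eq_integral => x /[!inE] Dx; rewrite !funeposE -!EFin_max -EFinM.
  by rewrite maxr_pMl ?w0// mul0r.
- apply: eq_integral => x /[!inE] Dx; rewrite !funenegE -!EFinN -!EFin_max -EFinM.
  by rewrite maxr_pMl ?w0// mul0r mulNr.
- exact: measurable_funeneg.
- exact: measurable_funepos.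
Qed.
End WeightedImage.

Section SeparatedFubini.
Context d1 d2 (T1 : measurableType d1) (T2 : measurableType d2) (R : realType).
Variables (m1 : {sigma_finite_measure set T1 -> \bar R})
  (m2 : {sigma_finite_measure set T2 -> \bar R}).

Lemma integral_separated (g : T1 -> R) (h : T2 -> R) A B :
  measurable A -> measurable B ->
  m1.-integrable A (EFin \o g) -> m2.-integrable B (EFin \o h) ->
  (\int[m1 \x m2]_(p in A `*` B) (g p.1 * h p.2)%:E)%E =
  (\int[m1]_(x in A) g x * \int[m2]_(y in B) h y)%:E.
Proof.
move=> mA mB ig ih; rewrite integral_mkcond.
pose g1 := g \_ A; pose h1 := h \_ B.
have ig1 : m1.-integrable setT (EFin \o g1).
  by rewrite /g1 -restrict_EFin; exact: ((integrable_mkcond _ mA).1 ig).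
have ih1 : m2.-integrable setT (EFin \o h1).
  by rewrite /h1 -restrict_EFin; exact: ((integrable_mkcond _ mB).1 ih).
have -> : ((fun p => (g p.1 * h p.2)%:E) \_ (A `*` B))%E =
    (fun p => (g1 p.1 * h1 p.2)%:E).
  apply/funext => -[x y]; rewrite /g1 /h1 !patchE /=.
  rewrite (_ : ((x, y) \in A `*` B) = (x \in A) && (y \in B)); last first.
    by apply/idP/andP; rewrite !inE /= ?inE => -[].
  by case: (x \in A); case: (y \in B); rewrite /= ?mul0r ?mulr0.
have mg1 := measurable_int _ ig1; have mh1 := measurable_int _ ih1.
have mgh : measurable_fun setT (fun p : T1 * T2 => (g1 p.1 * h1 p.2)%:E).
  apply/measurable_EFinP; apply: measurable_funM.
    by apply: measurableT_comp => //; exact/measurable_EFinP.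
  by apply: measurableT_comp => //; exact/measurable_EFinP.
have inth c : (\int[m2]_y (c * h1 y)%:E)%E = (c * \int[m2]_(y in B) h y)%:E.
  under eq_integral do rewrite EFinM.
  rewrite integralZl// EFinM; congr (_ * _)%E.
  rewrite Rintegral_mkcond -/h1 /Rintegral fineK//.
  exact: integrable_fin_num.
rewrite -integral12_prod_meas1; last first.
  apply/integrable12ltyP => //=.
  under eq_integral do under eq_integral do rewrite normrM EFinM.
  have mh2 : measurable_fun setT (fun y => `|h1 y|%:E).
    by apply/measurable_EFinP; apply: measurableT_comp => //; exact/measurable_EFinP.
  have mg2 : measurable_fun setT (fun y => `|g1 y|%:E).
    by apply/measurable_EFinP; apply: measurableT_comp => //; exact/measurable_EFinP.
  under eq_integral do rewrite ge0_integralZl ?lee_fin//.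
  have /integrableP[_ hoo] := ih1; have /integrableP[_ goo] := ig1.
  rewrite ge0_integralZr//.
  - apply: lte_mul_pinfty => //; first by apply: integral_ge0 => x _; rewrite lee_fin.
    by rewrite ge0_fin_numE//; apply: integral_ge0 => x _; rewrite lee_fin.
  - by apply: integral_ge0 => y _; rewrite lee_fin.
rewrite /fubini_F /=; under eq_integral do rewrite inth EFinM.
rewrite integralZr// [in RHS]EFinM; congr (_ * _)%E.
rewrite Rintegral_mkcond -/g1 /Rintegral fineK//.
exact: integrable_fin_num.
Qed.
End SeparatedFubini.

(** * One-dimensional integrals *)

Section TrigIntegrals.
Context (R : realType).
Local Notation leb := (@lebesgue_measure R).

Lemma continuous_itv_integrable (f : R -> R) (a b : R) : continuous f ->
  leb.-integrable `[a, b] (EFin \o f).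
Proof.
move=> cf; apply: continuous_compact_integrable; first exact: segment_compact.
by apply: continuous_subspaceT.
Qed.

Lemma Rintegral_FTC (f F : R -> R) (a b : R) : a < b -> continuous f ->
  (forall x, is_derive x (1 : R) F (f x)) ->
  \int[leb]_(x in `[a, b]) f x = F b - F a.
Proof.
move=> ab cf dF; rewrite /Rintegral (@continuous_FTC2 _ f F)//.
- exact: continuous_subspaceT.
- have cF : continuous F.
    move=> x; apply/differentiable_continuous; apply/derivable1_diffP.
    by have [] := dF x.
  split.
  + by move=> x _; have [] := dF x.
  + exact/cvg_at_right_filter/cF.
  + exact/cvg_at_left_filter/cF.
- by move=> x _; rewrite derive1E; have [_ ->] := dF x.
Qed.

Lemma sin_cos_2pin n : sin (n%:R * (pi *+ 2)) = 0 :> R /\ cos (n%:R * (pi *+ 2)) = 1 :> R.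
Proof.
elim: n => [|n [IHs IHc]]; first by rewrite mul0r sin0 cos0.
by rewrite -natr1 mulrDl mul1r sinD2pi cosD2pi.
Qed.

Lemma sin_cos_2piB a b :
  sin ((a%:R - b%:R) * (pi *+ 2)) = 0 :> R /\ cos ((a%:R - b%:R) * (pi *+ 2)) = 1 :> R.
Proof.
have [sa ca] := sin_cos_2pin a; have [sb cb] := sin_cos_2pin b.
by rewrite mulrBl sinB cosB sa ca sb cb; split; ring.
Qed.

Lemma Rintegral_cos_sin (r : R) : r != 0 ->
  sin (r * (pi *+ 2)) = 0 -> cos (r * (pi *+ 2)) = 1 ->
  \int[leb]_(t in `[0, pi *+ 2]) cos (r * t) = 0 /\
  \int[leb]_(t in `[0, pi *+ 2]) sin (r * t) = 0.
Proof.
move=> r0 sr cr.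
have pi0 : (0 : R) < pi *+ 2 by rewrite pmulrn_lgt0// pi_gt0.
have cl : continuous (fun t : R => r * t).
  by move=> t; apply: cvgM; [exact: cvg_cst|exact: cvg_id].
have dl (x : R) : is_derive x (1 : R) (fun t : R => r * t) r.
  by apply: is_derive_eq; rewrite /GRing.scale /= ; ring.
have cc : continuous (fun t : R => cos (r * t)).
  by move=> t; apply: (continuous_comp (cl t)); exact: continuous_cos.
have cs : continuous (fun t : R => sin (r * t)).
  by move=> t; apply: (continuous_comp (cl t)); exact: continuous_sin.
have dS (x : R) : is_derive x (1 : R) (fun t : R => r^-1 * sin (r * t)) (cos (r * x)).
  have := is_derive1_comp (is_derive_sin (r * x)) (dl x) => d.
  by apply: is_derive_eq; rewrite /GRing.scale /= mulrCA mulVf// mulr1.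
have dC (x : R) : is_derive x (1 : R) (fun t : R => - r^-1 * cos (r * t)) (sin (r * x)).
  have := is_derive1_comp (is_derive_cos (r * x)) (dl x) => d.
  apply: is_derive_eq; rewrite /GRing.scale /=.
  by rewrite !mulNr mulrN opprK mulrCA mulVf// mulr1.
split.
- by rewrite (Rintegral_FTC pi0 cc dS) sr !mulr0 sin0 !mulr0 subrr.
- by rewrite (Rintegral_FTC pi0 cs dC) cr mulr0 cos0 subrr.
Qed.

Lemma continuous_cosM (r : R) : continuous (fun t : R => cos (r * t)).
Proof.
move=> t; apply: (@continuous_comp _ _ _ (fun t => r * t)).
  by apply: cvgM; [exact: cvg_cst|exact: cvg_id].
exact: continuous_cos.
Qed.

Lemma continuous_sinM (r : R) : continuous (fun t : R => sin (r * t)).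
Proof.
move=> t; apply: (@continuous_comp _ _ _ (fun t => r * t)).
  by apply: cvgM; [exact: cvg_cst|exact: cvg_id].
exact: continuous_sin.
Qed.

(** The frequencies are integers, so unless they are equal the primitive has the
same value at 0 and at [2 pi]. *)
Lemma Rintegral_cosB_sinB a b :
  \int[leb]_(t in `[0, pi *+ 2]) cos ((a%:R - b%:R) * t) =
    (a == b)%:R * (pi *+ 2) /\
  \int[leb]_(t in `[0, pi *+ 2]) sin ((a%:R - b%:R) * t) = 0.
Proof.
have pi0 : (0 : R) < pi *+ 2 by rewrite pmulrn_lgt0// pi_gt0.
have [->|ab] := eqVneq a b.
  rewrite subrr; under eq_Rintegral do rewrite mul0r cos0.
  under [X in _ /\ X = _]eq_Rintegral do rewrite mul0r sin0.
  rewrite !Rintegral_cst//= lebesgue_measure_itv/= lte_fin pi0 -EFinD/= subr0.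
  by rewrite mul0r.
have [sr cr] := sin_cos_2piB a b.
rewrite mul0r; apply: Rintegral_cos_sin => //.
by rewrite subr_eq0 eqr_nat.
Qed.

Lemma Rintegral_cosD_sinD a b :
  \int[leb]_(t in `[0, pi *+ 2]) cos ((a%:R + b%:R) * t) =
    ((a == 0) && (b == 0))%N%:R * (pi *+ 2) /\
  \int[leb]_(t in `[0, pi *+ 2]) sin ((a%:R + b%:R) * t) = 0.
Proof.
have := Rintegral_cosB_sinB (a + b) 0.
by rewrite subr0 natrD addn_eq0.
Qed.

Lemma Rintegral_lin2 (f g : R -> R) (c d x y : R) :
  continuous f -> continuous g ->
  \int[leb]_(t in `[x, y]) (c * f t + d * g t) =
  c * \int[leb]_(t in `[x, y]) f t + d * \int[leb]_(t in `[x, y]) g t.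
Proof.
move=> cf cg; have If := continuous_itv_integrable x y cf.
have Ig := continuous_itv_integrable x y cg.
rewrite RintegralD//= ?RintegralZl//.
- exact: (@integrableZl _ _ _ _ _ _ c _ If).
- exact: (@integrableZl _ _ _ _ _ _ d _ Ig).
Qed.

Lemma trig_orthogonality a b :
  [/\ \int[leb]_(t in `[0, pi *+ 2]) (cos (a%:R * t) * cos (b%:R * t)) =
        ((a == b)%:R + ((a == 0) && (b == 0))%N%:R) * pi,
      \int[leb]_(t in `[0, pi *+ 2]) (sin (a%:R * t) * sin (b%:R * t)) =
        ((a == b)%:R - ((a == 0) && (b == 0))%N%:R) * pi &
      \int[leb]_(t in `[0, pi *+ 2]) (sin (a%:R * t) * cos (b%:R * t)) = 0].
Proof.
have [cB sB] := Rintegral_cosB_sinB a b; have [cD sD] := Rintegral_cosD_sinD a b.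
have cc := @continuous_cosM; have cs := @continuous_sinM.
split.
- transitivity (\int[leb]_(t in `[0, pi *+ 2])
     (2^-1 * cos ((a%:R - b%:R) * t) + 2^-1 * cos ((a%:R + b%:R) * t))).
    by apply: eq_Rintegral => t _; rewrite mulrBl mulrDl cosB cosD; field.
  by rewrite Rintegral_lin2// cB cD; field.
- transitivity (\int[leb]_(t in `[0, pi *+ 2])
     (2^-1 * cos ((a%:R - b%:R) * t) + - 2^-1 * cos ((a%:R + b%:R) * t))).
    by apply: eq_Rintegral => t _; rewrite mulrBl mulrDl cosB cosD; field.
  by rewrite Rintegral_lin2// cB cD; field.
- transitivity (\int[leb]_(t in `[0, pi *+ 2])
     (2^-1 * sin ((a%:R - b%:R) * t) + 2^-1 * sin ((a%:R + b%:R) * t))).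
    by apply: eq_Rintegral => t _; rewrite mulrBl mulrDl sinB sinD; field.
  by rewrite Rintegral_lin2// sB sD; field.
Qed.

(** The dependence of a spherical harmonic on the longitude. *)
Definition trig (m : int) (t : R) : R :=
  if m == 0 then 1
  else Num.sqrt 2 * (if 0 < m then cos (`|m|%N%:R * t) else sin (`|m|%N%:R * t)).

Lemma continuous_trig m : continuous (trig m).
Proof.
rewrite /trig; case: eqP => _ t; first exact: cvg_cst.
by case: ltP => _; apply: cvgM; (try exact: cvg_cst);
  [exact: continuous_cosM|exact: continuous_sinM].
Qed.

Lemma Rintegral_trig m m' :
  \int[leb]_(t in `[0, pi *+ 2]) (trig m t * trig m' t) = (m == m')%:R * (pi *+ 2).
Proof.
pose s (k : int) : R := if k == 0 then 1 else Num.sqrt 2.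
pose base (k : int) (t : R) := if k is Posz a then cos (a%:R * t) else sin (`|k|%N%:R * t).
have trigE k t : trig k t = s k * base k t.
  by case: k => [[|a]|a]; rewrite /trig /s /base /= ?mul1r// mul0r cos0.
have cbase k : continuous (base k).
  by case: k => a; [exact: continuous_cosM|exact: continuous_sinM].
transitivity (s m * s m' * \int[leb]_(t in `[0, pi *+ 2]) (base m t * base m' t)).
  rewrite -RintegralZl//; last first.
    by apply: continuous_itv_integrable => t; apply: cvgM; exact: cbase.
  by apply: eq_Rintegral => t _; rewrite !trigE; ring.
have s2 (k : int) : k != 0 -> s k * s k = 2.
  by move=> /negbTE; rewrite /s => ->; rewrite -expr2 sqr_sqrtr.
case: m m' => [a|a] [b|b]; rewrite /base.
- have [-> _ _] := trig_orthogonality a b.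
  have [ab|ab] := eqVneq a b; last first.
    have -> : (Posz a == Posz b) = false by apply/negbTE.
    have -> : (a == 0)%N && (b == 0)%N = false.
      by apply/negP => /andP[/eqP a0 /eqP b0]; move: ab; rewrite a0 b0.
    by rewrite addr0 !(mul0r, mulr0).
  rewrite -ab eqxx andbb; case: (a) => [|c]; first by rewrite /s /=; ring.
  by rewrite s2//=; ring.
- have [_ _] := trig_orthogonality b.+1 a => E.
  under eq_Rintegral do rewrite mulrC; by rewrite E mulr0 mul0r.
- have [_ _ ->] := trig_orthogonality a.+1 b; by rewrite mulr0 mul0r.
- have [_ -> _] := trig_orthogonality a.+1 b.+1.
  rewrite andFb subr0 eqSS (_ : (Negz a == Negz b) = (a == b)) //.
  by have [->|ab] := eqVneq a b; [rewrite s2//; ring|rewrite !mul0r mulr0].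
Qed.

(** The integral of [p] over [[-1, 1]], after the substitution by the cosine of
the colatitude. *)
Definition cosint (p : {poly R}) : R :=
  \int[leb]_(t in `[0, pi]) (p.[cos t] * sin t).

Lemma continuous_horner_cos_sin (p : {poly R}) : continuous (fun t => p.[cos t] * sin t).
Proof.
move=> t; apply: cvgM; last exact: continuous_sin.
apply: (@continuous_comp _ _ _ (@cos R)); first exact: continuous_cos.
exact: continuous_horner.
Qed.

Lemma cosint_linear (c : R) (p q : {poly R}) :
  cosint (c *: p + q) = c * cosint p + cosint q.
Proof.
transitivity (\int[leb]_(t in `[0, pi]) (c * (p.[cos t] * sin t) + 1 * (q.[cos t] * sin t))).
  by apply: eq_Rintegral => t _; rewrite hornerD hornerZ; ring.
by rewrite Rintegral_lin2 ?mul1r//; exact: continuous_horner_cos_sin.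
Qed.

Lemma cosint_deriv (p : {poly R}) : cosint p^`() = p.[1] - p.[-1].
Proof.
have dF (x : R) : is_derive x (1 : R) (fun t => - p.[cos t]) (p^`().[cos x] * sin x).
  have := is_derive1_comp (is_derive_poly p (cos x)) (is_derive_cos x) => d.
  by apply: is_derive_eq; rewrite mulrN opprK.
rewrite /cosint (Rintegral_FTC (pi_gt0 R) (@continuous_horner_cos_sin _) dF).
by rewrite cospi cos0 opprK addrC.
Qed.
End TrigIntegrals.

(** * Orthonormality of the spherical harmonics *)

Section SphereIntegral.
Context (R : realType).
Notation S2 := (sphere R).
Local Notation sigma := (@surface_measure R).
Local Notation leb := (@lebesgue_measure R).
Implicit Types (f g : S2 -> R).

Lemma measurable_coord j : measurable_fun setT (@sph_coord R j).
Proof.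
move=> _ B mB; apply: sub_sigma_algebra.
by exists j => //; exists B.
Qed.

Lemma measurable_spol n f : spol n f -> measurable_fun setT f.
Proof.
elim=> *; [exact: measurable_cst|exact: measurable_funD|].
by apply: measurable_funM => //; exact: measurable_coord.
Qed.

Lemma coord_le1 j (x : S2) : `|sph_coord j x| <= 1.
Proof.
rewrite -(@ler_pXn2r _ 2)// ?nnegrE// expr1n real_normK ?num_real// -(sphere_eq1 x).
by rewrite (bigD1 j)//= lerDl sumr_ge0// => k _; rewrite sqr_ge0.
Qed.

Lemma bounded_spol n f : spol n f -> exists K, forall x, `|f x| <= K.
Proof.
elim=> {n f} [n c|n f g _ [K fK] _ [M gM]|n j f _ [K fK]].
- by exists `|c|.
- by exists (K + M) => x; rewrite (le_trans (ler_normD _ _))// lerD.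
- exists K => x; rewrite normrM -[K]mul1r ler_pM//; exact: coord_le1.
Qed.

(** The surface measure is by definition the image of a weighted Lebesgue measure
under polar coordinates. *)
Lemma integral_surface f : measurable_fun setT f ->
  (\int[sigma]_x (f x)%:E =
   \int[(leb \x leb)%E]_(p in `[0%R, pi] `*` `[0%R, (pi *+ 2)%R])
      (f (polar p) * sin p.1)%:E)%E.
Proof.
move=> mf; apply: (@integral_weighted_image _ _ _ _ R (leb \x leb)%E sigma (@polar R)
  (`[0%R, pi] `*` `[0%R, (pi *+ 2)%R]) (fun p => sin p.1)) => //.
- exact: measurable_polar.
- exact: measurableX.
- apply: measurable_funTS; apply: measurableT_comp => //.
  by apply: continuous_measurable_fun; exact: continuous_sin.
- by move=> -[t p] [/= + _]; rewrite in_itv/= => ?; exact: sin_ge0_pi.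
Qed.

Lemma integral_surface_separated f (g h : R -> R) : measurable_fun setT f ->
  continuous g -> continuous h -> (forall p, f (polar p) = g p.1 * h p.2) ->
  (\int[sigma]_x (f x)%:E)%E =
  (\int[leb]_(t in `[0%R, pi]) (g t * sin t) *
   \int[leb]_(t in `[0%R, (pi *+ 2)%R]) h t)%:E.
Proof.
move=> mf cg ch fgh; rewrite integral_surface// -integral_separated//.
- by apply: eq_integral => p _; rewrite fgh mulrAC.
- apply: continuous_itv_integrable => t; apply: cvgM; first exact: cg.
  exact: continuous_sin.
- exact: continuous_itv_integrable.
Qed.

Lemma surface_measure_lty : (sigma setT < +oo)%E.
Proof.
have := @integral_surface_separated (fun=> 1) (fun=> 1) (fun=> 1)
  (measurable_cst _) (fun t => cvg_cst _) (fun t => cvg_cst _).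
rewrite integral_cst// mul1e => ->; first exact: ltry.
by move=> p; rewrite mulr1.
Qed.

Lemma integrable_bounded f K : measurable_fun setT f -> (forall x, `|f x| <= K) ->
  sigma.-integrable setT (EFin \o f).
Proof.
move=> mf fK; apply: measurable_bounded_integrable => //.
  exact: surface_measure_lty.
by exists K; split; [exact: num_real|move=> M KM x _; exact: le_trans (fK x) (ltW KM)].
Qed.

Lemma integrable_spol n f : spol n f -> sigma.-integrable setT (EFin \o f).
Proof.
by move=> fn; have [K fK] := bounded_spol fn; apply: integrable_bounded fK;
  exact: measurable_spol fn.
Qed.

Definition sint f : R := \int[sigma]_x f x.

Lemma sint_lin n m (c : R) f g : spol n f -> spol m g ->
  sint (fun x => c * f x + g x) = c * sint f + sint g.
Proof.
move=> /integrable_spol fi gm; have gi := integrable_spol gm.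
by rewrite /sint RintegralD// ?RintegralZl//; exact: (integrableZl measurableT c fi).
Qed.

Lemma sint_separated f (g h : R -> R) : measurable_fun setT f ->
  continuous g -> continuous h -> (forall p, f (polar p) = g p.1 * h p.2) ->
  sint f = \int[leb]_(t in `[0, pi]) (g t * sin t) *
   \int[leb]_(t in `[0, pi *+ 2]) h t.
Proof.
by move=> mf cg ch fgh; rewrite /sint /Rintegral (integral_surface_separated mf cg ch fgh).
Qed.

Lemma coord_polar (p : R * R) : [/\ sph_coord 0 (polar p) = sin p.1 * cos p.2,
  sph_coord 1 (polar p) = sin p.1 * sin p.2 & sph_coord 2 (polar p) = cos p.1].
Proof. by split; rewrite /sph_coord /= mxE. Qed.

Lemma Z_polar a (p : R * R) :
  reZ a (polar p) = sin p.1 ^+ a * cos (a%:R * p.2) /\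
  imZ a (polar p) = sin p.1 ^+ a * sin (a%:R * p.2).
Proof.
have [c0 c1 _] := coord_polar p.
elim: a => [|a [IHr IHi]]; first by rewrite /reZ /imZ !mul0r cos0 sin0 mulr1 mulr0.
rewrite reZS imZS c0 c1 IHr IHi -natr1 mulrDl mul1r cosD sinD exprS.
split; ring.
Qed.

Definition harm_norm l m : R :=
  Num.sqrt ((l.*2.+1)%:R / (4 * pi) * ((l - `|m|)`!%:R / (l + `|m|)`!%:R)).

(** For [m = 0] the power of [x_1 + i x_2] is 1, so the factor 1 of the
definition can be read as the real part of this power. *)
Lemma sph_harmE l m : sph_harm l m = (fun x : S2 =>
  harm_norm l m * (if m == 0 then 1 else Num.sqrt 2) *
  (((legendre R l)^`(`|m|)).[sph_coord 2 x] *
   (if 0 <= m then reZ `|m| x else imZ `|m| x))).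
Proof.
apply/funext => x; rewrite /sph_harm /= -/(harm_norm l m) -/(reZ _ x) -/(imZ _ x).
case: (ltgtP m 0) => [_|_|->]; rewrite ?(mulr0, mulr1, mul1r); try ring.
Qed.

Lemma sph_harm_polar l m (p : R * R) : sph_harm l m (polar p) =
  harm_norm l m * ((legendre R l)^`(`|m|)).[cos p.1] * sin p.1 ^+ `|m| * trig m p.2.
Proof.
rewrite sph_harmE /trig; have [_ _ ->] := coord_polar p.
have [-> ->] := Z_polar `|m| p.
case: (ltgtP m 0) => [_|_|->]; try ring.
by rewrite mul0r cos0; ring.
Qed.

(** Taking [|m|] derivatives lowers the degree of the Legendre factor by [|m|],
the degree of the equatorial factor. *)
Lemma spol_sph_harm l m : (`|m| <= l)%N -> spol l (@sph_harm R l m).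
Proof.
move=> ml; rewrite sph_harmE; apply: spolZ.
have sz : (size (legendre R l)^`(`|m|) <= (l - `|m|).+1)%N.
  rewrite legendreE; apply: leq_trans (size_scale_leq _ _) _.
  apply/leq_sizeP => i li; rewrite coef_derivn nth_default ?mul0rn//.
  by rewrite size_rodrigues; lia.
have := spolM (spol_horner 2 ((legendre R l)^`(`|m|)))
  (g := if 0 <= m then reZ `|m| else imZ `|m|) (m := `|m|).
case: ifP => _ sM; (apply: spol_le; last (apply: sM; by have [] := spol_Z R `|m|));
  lia.
Qed.

(** The longitude decides whether the orders agree; if they do, the colatitude
gives the weighted integral of two associated Legendre polynomials of the same
order. *)
Lemma sph_harm_orthonormal l m l' m' : (`|m| <= l)%N -> (`|m'| <= l')%N ->
  sint (fun x => sph_harm l m x * sph_harm l' m' x) = ((l == l') && (m == m'))%:R.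
Proof.
move=> ml ml'.
pose q : {poly R} := (legendre R l)^`(`|m|); pose q' : {poly R} := (legendre R l')^`(`|m'|).
pose G (t : R) := harm_norm l m * harm_norm l' m' *
  (q.[cos t] * q'.[cos t] * (sin t ^+ `|m| * sin t ^+ `|m'|)).
have ch (r : {poly R}) : continuous (fun t : R => r.[cos t]).
  by move=> t; apply: (@continuous_comp _ _ _ (@cos R));
    [exact: continuous_cos|exact: continuous_horner].
have cX n : continuous (fun t : R => sin t ^+ n).
  by move=> t; apply: (@continuous_comp _ _ _ (@sin R) (fun y => y ^+ n));
    [exact: continuous_sin|exact: exprn_continuous].
have cG : continuous G.
  move=> t; apply: cvgM; first exact: cvg_cst.
  by apply: cvgM; apply: cvgM; [exact: ch|exact: ch|exact: cX|exact: cX].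
have cT : continuous (fun t : R => trig m t * trig m' t).
  by move=> t; apply: cvgM; exact: continuous_trig.
rewrite (sint_separated (g := G) (h := fun t => trig m t * trig m' t))//; last 2 first.
- apply: measurable_funM; exact: (measurable_spol (spol_sph_harm _)).
- by move=> p; rewrite !sph_harm_polar /G /q /q'; ring.
rewrite Rintegral_trig; have [mm|mm] := eqVneq m m'; last by rewrite mul0r mulr0 andbF.
subst m'; rewrite andbT mul1r.
set a := `|m|%N; set N := harm_norm l m * harm_norm l' m.
have -> : \int[leb]_(t in `[0, pi]) (G t * sin t) =
    N * cosint ((1 - 'X^2) ^+ a * (q * q')).
  rewrite -RintegralZl//; last first.
    by apply: continuous_itv_integrable; exact: continuous_horner_cos_sin.
  apply: eq_Rintegral => t _; rewrite /G -exprMn -expr2 sin2cos2.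
  by rewrite !hornerM horner_exp hornerD hornerN hornerXn hornerC /N /a; ring.
have [ll|ll] := eqVneq l l'; last first.
  by rewrite (assoc_legendre_orth (@cosint_linear R) (@cosint_deriv R) _ ll) mulr0 mul0r.
subst l'; rewrite -[q * q']expr2 (assoc_legendre_norm (@cosint_linear R) (@cosint_deriv R) ml).
have nf (n : nat) : n`!%:R != 0 :> R by rewrite pnatr_eq0 -lt0n fact_gt0.
have pi0 : pi != 0 :> R by rewrite gt_eqF ?pi_gt0.
rewrite /N -expr2 sqr_sqrtr; last first.
  by rewrite !mulr_ge0 ?invr_ge0 ?mulr_ge0 ?ler0n ?pi_ge0.
have n0 : l.*2.+1%:R != 0 :> R by rewrite pnatr_eq0.
move: n0 (nf (l + a)%N) (nf (l - a)%N); rewrite -/a.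
move: (_.+1%:R) (_`!%:R) (_`!%:R) => x y z x0 y0 z0.
move: (@pi R) pi0 => p p0.
by rewrite /=; field; rewrite x0 y0 z0 p0.
Qed.
End SphereIntegral.

(** * Polynomials are combinations of spherical harmonics *)

Section Completeness.
Context (R : realType).
Notation S2 := (sphere R).
Implicit Types (f g : S2 -> R).

(** On the sphere [x_3^2] is a polynomial in [x_1] and [x_2], so monomials with
exponent of [x_3] at most 1 suffice. The [2 l + 1] of them with degree [l] are
numbered so that they have the same indices as the harmonics of degree [l]. *)
Definition sph_monomial l i (x : S2) : R :=
  if (i <= l)%N then sph_coord 0 x ^+ i * sph_coord 1 x ^+ (l - i)
  else sph_coord 0 x ^+ (i - l.+1) * sph_coord 1 x ^+ (l.*2 - i) * sph_coord 2 x.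

(** Span of the monomials above, as an inductive predicate so that closure
under the operations is proved one monomial at a time. *)
Inductive mspan n : (S2 -> R) -> Prop :=
| mspan0 : mspan n (fun=> 0)
| mspanD c l i f : (l <= n)%N -> (i <= l.*2)%N -> mspan n f ->
    mspan n (fun x => c * sph_monomial l i x + f x).

Lemma mspan_add n f g : mspan n f -> mspan n g -> mspan n (fun x => f x + g x).
Proof.
move=> + gn; elim=> {f} [|c l i f ln il _ IH]; first by under eq_fun do rewrite add0r.
by under eq_fun do rewrite -addrA; exact: mspanD.
Qed.

Lemma mspan_scale n c f : mspan n f -> mspan n (fun x => c * f x).
Proof.
elim=> {f} [|d l i f ln il _ IH]; first by under eq_fun do rewrite mulr0; exact: mspan0.
by under eq_fun do rewrite mulrDr mulrA; exact: mspanD.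
Qed.

Lemma mspan_monomial n l i : (l <= n)%N -> (i <= l.*2)%N -> mspan n (sph_monomial l i).
Proof.
move=> ln il; rewrite (_ : sph_monomial l i = fun x => 1 * sph_monomial l i x + 0).
  by apply: mspanD => //; exact: mspan0.
by apply/funext => x; rewrite mul1r addr0.
Qed.

Lemma coord2_sqr (x : S2) :
  sph_coord 2 x ^+ 2 = 1 - sph_coord 0 x ^+ 2 - sph_coord 1 x ^+ 2.
Proof.
have := sphere_eq1 x; rewrite !big_ord_recl big_ord0 addr0 => <-.
have -> : lift ord0 ord0 = 1 :> 'I_3 by exact: val_inj.
have -> : lift ord0 (lift ord0 ord0) = 2 :> 'I_3 by exact: val_inj.
have -> : ord0 = 0 :> 'I_3 by exact: val_inj.
ring.
Qed.

Lemma mspan_coord_monomial n l i j : (l <= n)%N -> (i <= l.*2)%N ->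
  mspan n.+1 (fun x => sph_coord j x * sph_monomial l i x).
Proof.
move=> ln il.
have j3 : [\/ j = 0, j = 1 | j = 2].
  by case: j => -[|[|[|//]]] ?; [constructor 1|constructor 2|constructor 3]; exact: val_inj.
have [li|li] := leqP i l.
- case: j3 => ->.
  + rewrite (_ : (fun x => _) = sph_monomial l.+1 i.+1); first by apply: mspan_monomial; lia.
    by apply/funext => x; rewrite /sph_monomial li ltnS li subSS exprS; ring.
  + rewrite (_ : (fun x => _) = sph_monomial l.+1 i); first by apply: mspan_monomial; lia.
    by apply/funext => x; rewrite /sph_monomial li (leqW li) subSn// exprS; ring.
  + rewrite (_ : (fun x => _) = sph_monomial l.+1 (i + l.+2)); first by apply: mspan_monomial; lia.
    apply/funext => x; rewrite /sph_monomial li ifF; last by apply/negbTE; lia.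
    rewrite addnK (_ : l.+1.*2 - (i + l.+2) = l - i)%N; last by lia.
    ring.
- have -> : i = (l.+1 + (i - l.+1))%N by lia.
  have : (i - l.+1 < l)%N by lia.
  move: (i - l.+1)%N => a {i il li} al.
  have monomialE b k : (b <= k)%N -> sph_monomial k.+1 (k.+2 + b) =
      (fun x => sph_coord 0 x ^+ b * sph_coord 1 x ^+ (k - b) * sph_coord 2 x).
    move=> bk; apply/funext => x; rewrite /sph_monomial ifF; last by apply/negbTE; lia.
    by rewrite addKn (_ : k.+1.*2 - (k.+2 + b) = k - b)%N//; lia.
  case: l al ln => // l; rewrite ltnS => al ln.
  rewrite monomialE//.
  case: j3 => ->.
  + rewrite (_ : (fun x => _) = sph_monomial l.+2 (l.+3 + a.+1)).
      by apply: mspan_monomial; lia.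
    by rewrite monomialE//; apply/funext => x; rewrite subSS exprS; ring.
  + rewrite (_ : (fun x => _) = sph_monomial l.+2 (l.+3 + a)); first by apply: mspan_monomial; lia.
    rewrite monomialE; last by lia.
    by apply/funext => x; rewrite subSn// exprS; ring.
  (* x_3 times a monomial that already contains x_3: eliminate x_3^2 *)
  + rewrite (_ : (fun x => _) = (fun x => sph_monomial l a x +
       (-1 * sph_monomial l.+2 a.+2 x + -1 * sph_monomial l.+2 a x))).
      apply: mspan_add; first by apply: mspan_monomial; lia.
      by apply: mspan_add; apply: mspan_scale; apply: mspan_monomial; lia.
    apply/funext => x; rewrite /sph_monomial al !ltnS al (_ : a <= l.+2)%N; last by lia.
    rewrite !subSS (_ : l.+2 - a = (l - a).+2)%N; last by lia.
    transitivity (sph_coord 0 x ^+ a * sph_coord 1 x ^+ (l - a) * sph_coord 2 x ^+ 2).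
      by ring.
    by rewrite coord2_sqr !exprS; ring.
Qed.

Lemma mspan_coord n f j : mspan n f -> mspan n.+1 (fun x => sph_coord j x * f x).
Proof.
elim=> {f} [|c l i f ln il _ IH]; first by under eq_fun do rewrite mulr0; exact: mspan0.
under eq_fun do rewrite mulrDr mulrCA.
by apply: mspan_add => //; apply: mspan_scale; exact: mspan_coord_monomial.
Qed.

Lemma mspan_spol n f : spol n f -> mspan n f.
Proof.
elim=> {n f} [n c|n f g _ fn _ gn|n j f _ fn].
- rewrite (_ : (fun=> c) = fun x => c * sph_monomial 0 0 x).
    by apply: mspan_scale; exact: mspan_monomial.
  by apply/funext => x; rewrite /sph_monomial /= !mulr1.
- exact: mspan_add.
- exact: mspan_coord.
Qed.

Lemma spol_monomial l i : (i <= l.*2)%N -> spol l (@sph_monomial l i).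
Proof.
have sX j n : spol n (fun x : S2 => sph_coord j x ^+ n).
  elim: n => [|n IH]; first exact: spol_cst.
  by under eq_fun do rewrite exprS; exact: spolX.
move=> il; rewrite /sph_monomial; case: (leqP i l) => li.
  by apply: (@spol_le _ (i + (l - i))); [lia|exact: spolM].
apply: (@spol_le _ ((i - l.+1) + (l.*2 - i) + 1)); first by lia.
by apply: spolM; [exact: spolM|exact: spol_coord].
Qed.

Section FixedDegree.
Variable kappa : nat.

Definition harm_index : finType := {l : 'I_kappa.+1 & 'I_(l.*2.+1)}.
Implicit Types p q : harm_index.
Definition harm_deg p : nat := tag p.
Definition harm_ord p : int := deg_order (tagged p).
Definition harm p : S2 -> R := sph_harm (harm_deg p) (harm_ord p).
Definition monom p : S2 -> R := sph_monomial (harm_deg p) (tagged p).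

Lemma harm_ord_le p : (`|harm_ord p| <= harm_deg p)%N.
Proof.
by rewrite /harm_ord /deg_order /harm_deg; have := ltn_ord (tagged p); lia.
Qed.

Lemma harm_deg_le p : (harm_deg p <= kappa)%N.
Proof. exact: ltn_ord (tag p). Qed.

Lemma harm_deg_ord_eq p q : (harm_deg p == harm_deg q) && (harm_ord p == harm_ord q) = (p == q).
Proof.
apply/andP/eqP => [[/eqP + /eqP]|->//].
case: p q => [l i] [l' i']; rewrite /harm_deg /harm_ord /deg_order /= => /val_inj ll.
move: i'; rewrite -{}ll => i' /addIr [] /val_inj -> //.
Qed.

Lemma spol_harm p : spol (harm_deg p) (harm p).
Proof. exact: spol_sph_harm (harm_ord_le p). Qed.

Lemma spol_harm_top p : spol kappa (harm p).
Proof. exact: spol_le (harm_deg_le p) (spol_harm p). Qed.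

Lemma spol_monom p : spol kappa (monom p).
Proof.
apply: spol_le (harm_deg_le p) _; apply: spol_monomial.
by have := ltn_ord (tagged p); rewrite ltnS.
Qed.

Lemma harm_orthonormal p q : sint (fun x => harm p x * harm q x) = (p == q)%:R.
Proof. by rewrite sph_harm_orthonormal ?harm_ord_le// harm_deg_ord_eq. Qed.

Lemma spol_monom_coef f : spol kappa f -> exists c : harm_index -> R,
  f = fun x => \sum_p c p * monom p x.
Proof.
move=> /mspan_spol; elim=> {f} [|c l i f ln il _ [d ->]].
  by exists (fun=> 0); apply/funext => x; rewrite big1// => p _; rewrite mul0r.
have ll : (l < kappa.+1)%N by [].
have ii : (i < (Ordinal ll).*2.+1)%N by [].
pose p0 : harm_index := Tagged (fun l : 'I_kappa.+1 => 'I_(l.*2.+1)) (Ordinal ii).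
exists (fun p => c * (p == p0)%:R + d p); apply/funext => x.
under [RHS]eq_bigr do rewrite mulrDl.
rewrite big_split/= [X in _ = X + _](bigD1 p0)//= eqxx mulr1 [X in _ = _ + X + _]big1 ?addr0//.
by move=> p /negbTE ->; rewrite mulr0 mul0r.
Qed.

Lemma sint_sum_integrable (I : finType) (F : I -> S2 -> R) (c : I -> R) :
  (forall i, (@surface_measure R).-integrable setT (EFin \o F i)) ->
  sint (fun x => \sum_i c i * F i x) = \sum_i c i * sint (F i).
Proof.
move=> Fi; rewrite /index_enum; elim: (Finite.enum _) => [|i s IH].
  by under eq_fun do rewrite big_nil; rewrite big_nil /sint Rintegral_cst//= mul0r.
under eq_fun do rewrite big_cons.
rewrite big_cons -IH /sint -RintegralZl// -RintegralD//.
  exact: (integrableZl measurableT (c i) (Fi i)).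
rewrite (_ : _ \o _ = (fun x => \sum_(j <- s) (c j)%:E * (F j x)%:E)%E).
  by apply: integrable_sum => // j _; exact: (integrableZl measurableT (c j) (Fi j)).
by apply/funext => x /=; rewrite -sumEFin.
Qed.

Lemma sint_sum (I : finType) (F : I -> S2 -> R) (c : I -> R) n :
  (forall i, spol n (F i)) ->
  sint (fun x => \sum_i c i * F i x) = \sum_i c i * sint (F i).
Proof. by move=> Fn; apply: sint_sum_integrable => i; exact: integrable_spol (Fn i). Qed.

(** The harmonics are as many as the monomials [monom] that span all polynomials
of degree at most [kappa]. Orthonormality reads [A G A^T = 1], where [A] expresses
the harmonics in the monomials and [G] is the Gram matrix of the monomials; as [A]
is square, [G A^T] is also a left inverse of [A], so it expresses the monomials in
the harmonics. *)
Lemma spol_harm_coef f : spol kappa f -> exists c : harm_index -> R,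
  f = fun x => \sum_p c p * harm p x.
Proof.
have /choice[A AE] p := spol_monom_coef (spol_harm_top p).
move=> /spol_monom_coef[c ->].
pose N := #|harm_index|; pose v (i : 'I_N) : harm_index := enum_val i.
pose Am : 'M[R]_N := \matrix_(i, j) A (v i) (v j).
pose Gm : 'M[R]_N := \matrix_(i, j) sint (fun x => monom (v i) x * monom (v j) x).
have sumv (F : harm_index -> R) : \sum_p F p = \sum_i F (v i).
  by rewrite (reindex (@enum_val _ harm_index))//; exact/onW_bij/enum_val_bij.
have AGA : Am *m (Gm *m Am^T) = 1%:M.
  apply/matrixP => i k; rewrite mxE [RHS]mxE -[(i == k)]/(i == k).
  rewrite -(inj_eq enum_val_inj) -harm_orthonormal {1}(AE (v i)).
  transitivity (sint (fun x => \sum_p A (v i) p * (monom p x * harm (v k) x))); last first.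
    by congr sint; apply/funext => x; rewrite mulr_suml; apply: eq_bigr => p _; rewrite mulrA.
  rewrite (sint_sum _ (fun p => spolM (spol_monom p) (spol_harm_top (v k)))) sumv.
  apply: eq_bigr => j _; rewrite !mxE; congr (_ * _).
  transitivity (sint (fun x => \sum_p A (v k) p * (monom (v j) x * monom p x))).
    rewrite (sint_sum _ (fun p => spolM (spol_monom (v j)) (spol_monom p))) sumv.
    by apply: eq_bigr => q _; rewrite !mxE mulrC.
  congr sint; apply/funext => x; rewrite (AE (v k)) mulr_sumr.
  by apply: eq_bigr => p _; rewrite mulrCA.
(* a one-sided inverse of a square matrix is two-sided *)
have /matrixP BA := mulmx1C AGA.
exists (fun p => \sum_i c (v i) * (Gm *m Am^T) i (enum_rank p)); apply/funext => x.
under [RHS]eq_bigr do rewrite mulr_suml.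
rewrite exchange_big/= sumv; apply: eq_bigr => i _.
under eq_bigr do rewrite -mulrA.
rewrite -mulr_sumr; congr (_ * _); rewrite sumv.
transitivity (\sum_k (1%:M : 'M[R]_N) i k * monom (v k) x).
  rewrite (bigD1 i)//= mxE eqxx mul1r big1 ?addr0// => k ki.
  by rewrite mxE eq_sym (negbTE ki) mul0r.
under eq_bigr do rewrite -BA mxE mulr_suml.
rewrite exchange_big/=; apply: eq_bigr => j _.
rewrite (AE (v j)) mulr_sumr sumv enum_valK; apply: eq_bigr => k _.
by rewrite !mxE mulrA.
Qed.

End FixedDegree.
End Completeness.

(** * Expansions in spherical harmonics *)

Section Expansion.
Context (R : realType) (kappa : nat).
Notation S2 := (sphere R).
Notation idx := (harm_index kappa).
Implicit Types (f g : S2 -> R) (p q : idx).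
Notation Yb := (@harm R kappa).

Definition expansion (c : idx -> R) : S2 -> R := fun x => \sum_p c p * Yb p x.

Lemma spol_expansion c : spol kappa (expansion c).
Proof. by apply: spol_sum => p _; apply: spolZ; exact: spol_harm_top. Qed.

Lemma sum_deltar p (F : idx -> R) : \sum_q F q * (q == p)%:R = F p.
Proof.
by rewrite (bigD1 p)//= eqxx mulr1 big1 ?addr0// => q /negbTE ->; exact: mulr0.
Qed.

Lemma sint_expansionM c f n : spol n f ->
  sint (fun x => expansion c x * f x) = \sum_p c p * sint (fun x => Yb p x * f x).
Proof.
move=> fn; rewrite -(sint_sum _ (fun p => spolM (spol_harm_top R p) fn)).
by congr sint; apply/funext => x; rewrite mulr_suml; apply: eq_bigr => p _; rewrite mulrA.
Qed.

Lemma coef_expansion c p : sint (fun x => expansion c x * Yb p x) = c p.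
Proof.
rewrite (sint_expansionM _ (spol_harm_top R p)).
by under eq_bigr do rewrite harm_orthonormal; exact: sum_deltar.
Qed.

Lemma sint_expansion2 c d :
  sint (fun x => expansion c x * expansion d x) = \sum_p c p * d p.
Proof.
rewrite (sint_expansionM _ (spol_expansion d)); apply: eq_bigr => p _; congr (_ * _).
rewrite -[RHS](coef_expansion d); congr sint; apply/funext => x; exact: mulrC.
Qed.

Definition rcoef f p := sint (fun x => f x * Yb p x).

(** Such a polynomial is an expansion by [spol_harm_coef], and orthonormality
recovers its coefficients; so the projection to [H^kappa] fixes it. *)
Lemma expansion_rcoef f : spol kappa f -> expansion (rcoef f) = f.
Proof.
move=> /spol_harm_coef[c fE].
have -> : rcoef f = c by apply/funext => p; rewrite /rcoef fE (coef_expansion c).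
by rewrite fE.
Qed.

Lemma rlap_harm p x : rlap (Yb p) x = - lambda R (harm_deg p) * Yb p x.
Proof.
rewrite /harm sph_harmE; have [rZ iZ] := rlap_legendreZ (harm_deg p) `|harm_ord p| x.
have sp := spol_horner 2 ((legendre R (harm_deg p))^`(`|harm_ord p|)).
have [sr si] := spol_Z R `|harm_ord p|.
have spr : spol _ (fun y : S2 =>
  ((legendre R (harm_deg p))^`(`|harm_ord p|)).[sph_coord 2 y] * reZ `|harm_ord p| y) := spolM sp sr.
have spi : spol _ (fun y : S2 =>
  ((legendre R (harm_deg p))^`(`|harm_ord p|)).[sph_coord 2 y] * imZ `|harm_ord p| y) := spolM sp si.
have Zr c := rlapZ c x spr; have Zi c := rlapZ c x spi.
move: Zr Zi rZ iZ => /= Zr Zi rZ iZ.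
by case: (0 <= harm_ord p); rewrite ?Zr ?Zi ?rZ ?iZ mulrCA.
Qed.

Lemma rlap_expansion c x :
  rlap (expansion c) x = expansion (fun p => - lambda R (harm_deg p) * c p) x.
Proof.
rewrite /expansion (rlap_sum _ x (fun p => spolZ (c p) (spol_harm_top R p))).
by apply: eq_bigr => p _; rewrite (rlapZ _ _ (spol_harm_top R p)) rlap_harm; ring.
Qed.

Lemma sint0 : sint (fun=> 0 : R) = 0 :> R.
Proof. by rewrite /sint Rintegral_cst//= mul0r. Qed.

Lemma sintZ n c f : spol n f -> sint (fun x => c * f x) = c * sint f.
Proof.
move=> fn; rewrite -[RHS]addr0 -sint0 -(sint_lin c fn (spol_cst 0 0)).
by congr sint; apply/funext => x; rewrite addr0.
Qed.

Lemma sph_harm00 : exists2 c : R, c != 0 & sph_harm 0 0 = (fun=> c) :> (S2 -> R).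
Proof.
have [c cE] : exists c : R, sph_harm 0 0 = (fun=> c) :> (S2 -> R).
  eexists; rewrite sph_harmE eqxx lexx -[`|0|%N]/0%N (legendre_top R 0).
  by apply/funext => x; rewrite hornerC /reZ /=; reflexivity.
exists c => //; apply/eqP => c0.
have := @sph_harm_orthonormal R 0 0 0 0 isT isT.
rewrite cE c0; under [X in sint X]eq_fun do rewrite mul0r.
by rewrite sint0 => /eqP; rewrite eq_sym oner_eq0.
Qed.

(** Orthogonality to the constant harmonic of degree 0. *)
Lemma sint_harm p : (0 < harm_deg p)%N -> sint (Yb p) = 0.
Proof.
move=> p0; have [c c0 cE] := sph_harm00.
apply: (mulfI c0); rewrite mulr0 -(sintZ c (spol_harm R p)).
have := @sph_harm_orthonormal R (harm_deg p) (harm_ord p) 0 0 (harm_ord_le p) isT.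
rewrite cE gtn_eqF//= => E; apply: (eq_trans _ E).
by congr sint; apply/funext => x; rewrite mulrC.
Qed.

(** Integration by parts on the sphere, obtained from the spectrum: harmonics of
positive degree have integral 0, and those of degree 0 have eigenvalue 0. *)
Lemma sint_rlap f : spol kappa f -> sint (rlap f) = 0.
Proof.
move=> /expansion_rcoef <-.
rewrite (_ : rlap _ = expansion (fun p => - lambda R (harm_deg p) * rcoef f p)); last first.
  by apply/funext => x; rewrite rlap_expansion.
rewrite (sint_sum _ (@spol_harm_top R kappa)) big1// => p _.
have [p0|p0] := posnP (harm_deg p); last by rewrite sint_harm// mulr0.
by rewrite p0 /lambda mul0n oppr0 !mul0r.
Qed.

End Expansion.

(** * Green's formula and the projected gradient *)

Section Energy.
Context (R : realType).
Notation S2 := (sphere R).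
Implicit Types (f g : S2 -> R).

Lemma spol_rlap n f : spol n f -> spol n.+2 (rlap f).
Proof. by move=> fn; apply: spol_sum => j _; do 2 apply: spol_rgrad. Qed.

(** Green's formula for two eigenfunctions: integrate the product rule
[rlapM]. *)
Lemma sint_gdot n f g (a b : R) : spol n f -> spol n g ->
  (forall x, rlap f x = - a * f x) -> (forall x, rlap g x = - b * g x) ->
  sint (gdot f g) = 2^-1 * (a + b) * sint (fun x => f x * g x).
Proof.
move=> fn gn fa gb; have fgn := spolM fn gn.
have s1 := sint_rlap fgn.
transitivity (sint (fun x => 2^-1 * (rlap (fun y => f y * g y) x) +
    2^-1 * (a + b) * (f x * g x))).
  by congr sint; apply/funext => x; rewrite (rlapM x fn gn) fa gb; field.
have s2 : spol _ (fun x => 2^-1 * (a + b) * (f x * g x)) := spolZ _ fgn.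
apply: (eq_trans (sint_lin _ (spol_rlap fgn) s2)).
rewrite s1 mulr0 add0r.
exact: sintZ fgn.
Qed.

Variable kappa : nat.
Notation idx := (harm_index kappa).
Implicit Types (p q : idx).
Notation Yb := (@harm R kappa).

Definition gradcoef (j : 'I_3) q p : R := rcoef (rgrad j (Yb p)) q.

Lemma rcoef_rgrad_expansion j q (c : idx -> R) :
  rcoef (rgrad j (expansion c)) q = \sum_p c p * gradcoef j q p.
Proof.
rewrite /rcoef /expansion (rgrad_sumE j _ (fun p => spolZ (c p) (spol_harm_top R p))).
rewrite -(sint_sum _ (fun p => spolM (spol_rgrad j (spol_harm_top R p)) (spol_harm_top R q))).
congr sint; apply/funext => x; rewrite mulr_suml; apply: eq_bigr => p _.
by rewrite (rgradZE j _ (spol_harm_top R p)) mulrA.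
Qed.

(** The projected gradients of harmonics of different degrees are orthogonal,
although the projection does act on the gradient of the higher degree when that
degree is [kappa]. *)
Lemma gradcoef_orth p p' : harm_deg p != harm_deg p' ->
  \sum_j \sum_q gradcoef j q p * gradcoef j q p' = 0.
Proof.
(* one of two different degrees is below kappa, and the claim is symmetric *)
wlog pk : p p' / (harm_deg p < kappa)%N.
  move=> H pp'; have [pk|pk] := ltnP (harm_deg p) kappa; first exact: H.
  under eq_bigr do under eq_bigr do rewrite mulrC.
  apply: H; rewrite 1?eq_sym//.
  rewrite ltn_neqAle harm_deg_le andbT.
  by apply: contraNN pp' => /eqP ->; rewrite eqn_leq harm_deg_le.
move=> pp'.
transitivity (\sum_j sint (fun x => rgrad j (Yb p) x * rgrad j (Yb p') x)).
  apply: eq_bigr => j _.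
  have gp : spol kappa (rgrad j (Yb p)).
    by apply: spol_le (spol_rgrad j (spol_harm R p)).
  rewrite -[in RHS](expansion_rcoef gp).
  rewrite (sint_expansionM _ (spol_rgrad j (spol_harm_top R p'))).
  apply: eq_bigr => q _; congr (_ * _); congr sint.
  by apply/funext => x; rewrite mulrC.
have Yk q := spol_harm_top R q.
have -> : \sum_j sint (fun x => rgrad j (Yb p) x * rgrad j (Yb p') x) =
    sint (gdot (Yb p) (Yb p')).
  transitivity (\sum_j 1 * sint (fun x => rgrad j (Yb p) x * rgrad j (Yb p') x)).
    by apply: eq_bigr => j _; rewrite mul1r.
  rewrite -(sint_sum _ (fun j => spolM (spol_rgrad j (Yk p)) (spol_rgrad j (Yk p')))).
  by congr sint; apply/funext => x; apply: eq_bigr => j _; rewrite mul1r.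
rewrite (sint_gdot (Yk p) (Yk p') (rlap_harm p) (rlap_harm p')) harm_orthonormal.
by rewrite (_ : (p == p') = false) ?mulr0//; apply/negbTE; apply: contraNN pp' => /eqP ->.
Qed.
End Energy.

(** * Real and imaginary parts *)

Section ComplexLayer.
Context (R : realType).
Notation Cx := R[i].
Notation S2 := (sphere R).
Implicit Types (u : S2 -> Cx).

Definition reF u : S2 -> R := fun x => complex.Re (u x).
Definition imF u : S2 -> R := fun x => complex.Im (u x).

Lemma coefE u l m : coef u l m =
  sint (fun x => reF u x * sph_harm l m x) +i* sint (fun x => imF u x * sph_harm l m x).
Proof.
rewrite /coef /inner /cintegral /sint; congr (_ +i* _); apply: eq_Rintegral => x _;
  rewrite /Ylm /reF /imF; case: (u x) => a b /=; ring.
Qed.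

Lemma inner_norm u : complex.Re (inner u u) = sint (fun x => reF u x ^+ 2 + imF u x ^+ 2).
Proof.
by apply: eq_Rintegral => x _; rewrite /reF /imF; case: (u x) => a b /=; ring.
Qed.

Lemma norm2_sq u : norm2 u ^+ 2 = sint (fun x => reF u x ^+ 2 + imF u x ^+ 2).
Proof.
rewrite /norm2 sqr_sqrtr inner_norm// /sint.
by apply: Rintegral_ge0 => x _; rewrite addr_ge0// sqr_ge0.
Qed.

Lemma ReD (a b : Cx) : complex.Re (a + b) = complex.Re a + complex.Re b.
Proof. by case: a; case: b. Qed.
Lemma ImD (a b : Cx) : complex.Im (a + b) = complex.Im a + complex.Im b.
Proof. by case: a; case: b. Qed.

Lemma Re_sum (I : Type) (r : seq I) (F : I -> Cx) :
  complex.Re (\sum_(i <- r) F i) = \sum_(i <- r) complex.Re (F i).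
Proof. by elim/big_rec2: _ => // i x y _ <-; rewrite ReD. Qed.
Lemma Im_sum (I : Type) (r : seq I) (F : I -> Cx) :
  complex.Im (\sum_(i <- r) F i) = \sum_(i <- r) complex.Im (F i).
Proof. by elim/big_rec2: _ => // i x y _ <-; rewrite ImD. Qed.

Section Fixed.
Variable kappa : nat.
Notation idx := (harm_index kappa).
Notation Yb := (@harm R kappa).

Lemma sum_harm_index (F : nat -> int -> R) :
  \sum_(l < kappa.+1) \sum_(i < l.*2.+1) F l (deg_order i) =
  \sum_(p : idx) F (harm_deg p) (harm_ord p).
Proof.
exact: (sig_big_dep (fun=> true) (fun _ _ => true)
  (fun (l : 'I_kappa.+1) (i : 'I_l.*2.+1) => F l (deg_order i))).
Qed.

Lemma reF_sph_proj u : reF (sph_proj kappa u) = expansion (rcoef (kappa := kappa) (reF u)).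
Proof.
apply/funext => x; rewrite /reF /sph_proj Re_sum.
under eq_bigr do rewrite Re_sum.
rewrite (sum_harm_index (fun l m => complex.Re (mode u l m x))); apply: eq_bigr => p _.
by rewrite /mode coefE /= mulr0 subr0.
Qed.

Lemma imF_sph_proj u : imF (sph_proj kappa u) = expansion (rcoef (kappa := kappa) (imF u)).
Proof.
apply/funext => x; rewrite /imF /sph_proj Im_sum.
under eq_bigr do rewrite Im_sum.
rewrite (sum_harm_index (fun l m => complex.Im (mode u l m x))); apply: eq_bigr => p _.
by rewrite /mode coefE /= mulr0 add0r.
Qed.

Lemma mass_expansion u (a b : idx -> R) : reF u = expansion a -> imF u = expansion b ->
  mass u = \sum_p (a p ^+ 2 + b p ^+ 2).
Proof.
move=> ua ub; rewrite /mass norm2_sq ua ub.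
have sa := spol_expansion a; have sb := spol_expansion b.
transitivity (sint (fun x => 1 * (expansion a x * expansion a x) + expansion b x * expansion b x)).
  by congr sint; apply/funext => x; ring.
rewrite (sint_lin _ (spolM sa sa) (spolM sb sb)) mul1r !sint_expansion2 -big_split/=.
by apply: eq_bigr => p _; ring.
Qed.

Lemma norm2_proj u : norm2 (sph_proj kappa u) ^+ 2 =
  \sum_(p : idx) (rcoef (reF u) p ^+ 2 + rcoef (imF u) p ^+ 2).
Proof. exact: mass_expansion (reF_sph_proj u) (imF_sph_proj u). Qed.

(** Parseval's identity for the projected gradient. *)
Lemma energyE u : energy kappa u = \sum_(j < 3) \sum_(p : idx)
  (rcoef (rgrad j (reF u)) p ^+ 2 + rcoef (rgrad j (imF u)) p ^+ 2).
Proof.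
rewrite /energy /vnorm2 sqr_sqrtr; last by apply: sumr_ge0 => j _; rewrite sqr_ge0.
by apply: eq_bigr => j _; rewrite norm2_proj.
Qed.

(** The mode of degree 0 is constant. *)
Lemma energy_mode00 u : energy_mode kappa u 0 0 = 0.
Proof.
have [c _ cE] := sph_harm00 R.
have reM : reF (mode u 0 0) = fun=> complex.Re (coef u 0 0) * c.
  by apply/funext => x; rewrite /reF /mode /Ylm cE; case: (coef _ _ _) => a b /=; ring.
have imM : imF (mode u 0 0) = fun=> complex.Im (coef u 0 0) * c.
  by apply/funext => x; rewrite /imF /mode /Ylm cE; case: (coef _ _ _) => a b /=; ring.
rewrite /energy_mode -/(energy kappa (mode u 0 0)) energyE reM imM.
rewrite big1// => j _; rewrite big1// => p _; rewrite !rgrad_cstE /rcoef.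
under [X in sint X]eq_fun do rewrite mul0r.
by rewrite sint0 expr0n/= addr0.
Qed.

Lemma reF_laplace u : reF (laplace_beltrami u) = rlap (reF u).
Proof. by apply/funext => x; rewrite /reF /laplace_beltrami Re_sum. Qed.

Lemma imF_laplace u : imF (laplace_beltrami u) = rlap (imF u).
Proof. by apply/funext => x; rewrite /imF /laplace_beltrami Im_sum. Qed.

Lemma mass_mode00 u (a b : idx -> R) : reF u = expansion a -> imF u = expansion b ->
  mass_mode u 0 0 = \sum_(p | harm_deg p == 0%N) (a p ^+ 2 + b p ^+ 2).
Proof.
move=> ua ub.
have i0 : (0 < (@ord0 kappa).*2.+1)%N by [].
pose p0 : idx := Tagged (fun l : 'I_kappa.+1 => 'I_(l.*2.+1)) (Ordinal i0).
rewrite (big_pred1 p0); last first.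
  move=> p /=; rewrite -harm_deg_ord_eq /= (_ : harm_deg p0 = 0%N)//.
  have [d0|//] := eqVneq (harm_deg p) 0%N.
  have -> : harm_ord p = 0 by have := harm_ord_le p; rewrite d0; case: (harm_ord p) => -[].
  by [].
rewrite /mass_mode coefE -[sph_harm 0 0]/(Yb p0) ua ub !coef_expansion /=.
by rewrite sqr_sqrtr// addr_ge0 ?sqr_ge0.
Qed.
End Fixed.
End ComplexLayer.

(** * Growth of quadratic forms under the Euler step *)

Section QuadraticForm.
Context (R : realType) (kappa : nat) (K : finType).
Notation idx := (harm_index kappa).
Variable t : K -> idx -> R.
Implicit Types (a b : idx -> R).

(** The mass and the energy as functions of the real or of the imaginary parts of
the coefficients. *)
Definition qf a : R := \sum_k (\sum_p t k p * a p) ^+ 2.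

Lemma qf_ge0 a : 0 <= qf a.
Proof. by apply: sumr_ge0 => k _; exact: sqr_ge0. Qed.

Hypothesis t_orth : forall p q, harm_deg p != harm_deg q -> \sum_k t k p * t k q = 0.
Hypothesis t0 : forall k p, harm_deg p = 0%N -> t k p = 0.

Let B p q := \sum_k t k p * t k q.

Lemma qfE a : qf a = \sum_p \sum_q a p * a q * B p q.
Proof.
rewrite /qf /B.
under eq_bigr do rewrite expr2 big_distrlr /=.
rewrite exchange_big/=; apply: eq_bigr => p _.
rewrite exchange_big/=; apply: eq_bigr => q _.
by rewrite mulr_sumr; apply: eq_bigr => k _; ring.
Qed.

(** Real form of the multiplication of the coefficients by
[1 + i tau lambda]: on a block of fixed degree the two mixed terms cancel and the
sum of the two values is multiplied by [1 + (tau lambda)^2]. Here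
[lambda^2 = 4 + mu^2] with real [mu], so the excess over the factor [1 + 4 tau^2]
is again a value of the form, hence nonnegative. *)
Lemma qf_growth (tau : R) a b :
  (1 + 4 * tau ^+ 2) * (qf a + qf b) <=
  qf (fun p => a p - tau * lambda R (harm_deg p) * b p) +
  qf (fun p => b p + tau * lambda R (harm_deg p) * a p).
Proof.
pose mu (p : idx) : R := Num.sqrt (lambda R (harm_deg p) ^+ 2 - 4).
(* the smallest positive eigenvalue is 2, hence the 4 *)
have muE p : (0 < harm_deg p)%N -> mu p ^+ 2 = lambda R (harm_deg p) ^+ 2 - 4.
  move=> p0; rewrite sqr_sqrtr// subr_ge0 /lambda -natrX ler_nat.
  by case: (harm_deg p) p0 => // n _; nia.
rewrite -subr_ge0.
rewrite [X in 0 <= X](_ : _ = tau ^+ 2 * (qf (fun p => mu p * a p) + qf (fun p => mu p * b p))).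
  by rewrite mulr_ge0 ?sqr_ge0// addr_ge0 ?qf_ge0.
apply/eqP; rewrite subr_eq; apply/eqP.
rewrite !qfE -!big_split/= !mulr_sumr -big_split/=; apply: eq_bigr => p _.
rewrite -!big_split/= !mulr_sumr -big_split/=; apply: eq_bigr => q _.
have [pq|pq] := eqVneq (harm_deg p) (harm_deg q); last by rewrite /B t_orth// !mulr0; ring.
have [p0|p0] := posnP (harm_deg p).
  by rewrite /B big1 ?mulr0; [ring|move=> k _; rewrite t0// mul0r].
have mq : mu p = mu q by rewrite /mu pq.
have -> : lambda R (harm_deg q) = lambda R (harm_deg p) by rewrite pq.
rewrite -mq; have := muE p p0; move: (mu p) (lambda R (harm_deg p)) (B p q) => m l c E.
apply/eqP; rewrite -subr_eq0; apply/eqP.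
transitivity (tau ^+ 2 * c * (a p * a q + b p * b q) * ((l ^+ 2 - 4) - m ^+ 2)).
  by ring.
by rewrite E subrr mulr0.
Qed.
End QuadraticForm.

(** * The real inner product of complex square-integrable functions *)

Section L2Theory.
Context (R : realType).
Notation Cx := R[i].
Notation S2 := (sphere R).
Local Notation sigma := (@surface_measure R).
Implicit Types (f g h : S2 -> Cx).

Definition dotF f g : S2 -> R := fun x => reF f x * reF g x + imF f x * imF g x.
Definition re_inner f g : R := sint (dotF f g).

Lemma re_innerE f g : re_inner f g = complex.Re (inner f g).
Proof.
apply: eq_Rintegral => x _; rewrite /dotF /reF /imF.
by case: (f x) => a b; case: (g x) => c d /=; ring.
Qed.

Lemma norm2_re_inner f : norm2 f ^+ 2 = re_inner f f.
Proof. by rewrite norm2_sq; congr sint; apply/funext => x; rewrite /dotF !expr2. Qed.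

Lemma normc_dotF f x : Normc.normc (f x) ^+ 2 = dotF f f x.
Proof.
rewrite /dotF /reF /imF; case: (f x) => a b /=.
by rewrite sqr_sqrtr ?addr_ge0 ?sqr_ge0// !expr2.
Qed.

Lemma L2_measurable f : L2 f -> measurable_fun setT (reF f) /\ measurable_fun setT (imF f).
Proof. by case. Qed.

Lemma measurable_dotF f g : L2 f -> L2 g -> measurable_fun setT (dotF f g).
Proof.
move=> /L2_measurable[fr fi] /L2_measurable[gr gi].
by apply: measurable_funD; apply: measurable_funM.
Qed.

Lemma dotF_ge0 f x : 0 <= dotF f f x.
Proof. by rewrite addr_ge0// -expr2 sqr_ge0. Qed.

Lemma integrable_dotF_diag f : L2 f -> sigma.-integrable setT (EFin \o dotF f f).
Proof.
move=> fL; apply/integrableP; split; first by apply/measurable_EFinP; exact: measurable_dotF.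
case: (fL) => _ _; under eq_integral do rewrite normc_dotF.
congr (_ < _)%E; apply: eq_integral => x _ /=.
by rewrite ger0_norm// dotF_ge0.
Qed.

Lemma dotF_le f g x : `|dotF f g x| <= dotF f f x + dotF g g x.
Proof.
rewrite /dotF; move: (reF f x) (imF f x) (reF g x) (imF g x) => a b c d.
rewrite ler_norml; apply/andP; split.
- have := sqr_ge0 (a + c); have := sqr_ge0 (b + d); nra.
- have := sqr_ge0 (a - c); have := sqr_ge0 (b - d); nra.
Qed.

Lemma integrable_dotF f g : L2 f -> L2 g -> sigma.-integrable setT (EFin \o dotF f g).
Proof.
move=> fL gL; have If := integrable_dotF_diag fL; have Ig := integrable_dotF_diag gL.
apply: (le_integrable measurableT (g := EFin \o (fun x => dotF f f x + dotF g g x))).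
- by apply/measurable_EFinP; exact: measurable_dotF.
- move=> x _ /=; rewrite lee_fin [leRHS]ger0_norm; first exact: dotF_le.
  by apply: addr_ge0; exact: dotF_ge0.
  exact: (integrableD measurableT If Ig).
Qed.

Lemma L2B f g : L2 f -> L2 g -> L2 (fun x => f x - g x).
Proof.
move=> fL gL; have [fr fi] := L2_measurable fL; have [gr gi] := L2_measurable gL.
have reB : (fun x => complex.Re (f x - g x)) = reF f \- reF g.
  by apply/funext => x; rewrite /reF /=; case: (f x) => a b; case: (g x).
have imB : (fun x => complex.Im (f x - g x)) = imF f \- imF g.
  by apply/funext => x; rewrite /imF /=; case: (f x) => a b; case: (g x).
have mr : measurable_fun setT (fun x => complex.Re (f x - g x)).
  by rewrite reB; exact: measurable_funB.
have mi : measurable_fun setT (fun x => complex.Im (f x - g x)).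
  by rewrite imB; exact: measurable_funB.
split => //.
have If := integrable_dotF_diag fL; have Ig := integrable_dotF_diag gL.
have /integrableP[_] := integrableZl measurableT 2 (integrableD measurableT If Ig).
apply: le_lt_trans; apply: ge0_le_integral => //.
- by move=> x _; rewrite lee_fin sqr_ge0.
- under eq_fun do rewrite (normc_dotF (fun x => f x - g x)).
  by apply/measurable_EFinP; apply: measurable_funD; apply: measurable_funM.
- apply: measurableT_comp => //.
  by case/integrableP: (integrableZl measurableT 2 (integrableD measurableT If Ig)).
- move=> x _ /=; rewrite (normc_dotF (fun x => f x - g x)).
  rewrite lee_fin [leRHS]ger0_norm; last first.
    by apply: mulr_ge0 => //; apply: addr_ge0; exact: dotF_ge0.
  rewrite /dotF /reF /imF; case: (f x) => a b; case: (g x) => c d /=.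
  have := sqr_ge0 (a + c); have := sqr_ge0 (b + d); nra.
Qed.

Lemma re_innerBl f g h : L2 f -> L2 g -> L2 h ->
  re_inner (fun x => f x - g x) h = re_inner f h - re_inner g h.
Proof.
move=> fL gL hL; rewrite /re_inner /sint -RintegralB//; last 2 first.
  exact: integrable_dotF.
  exact: integrable_dotF.
apply: eq_Rintegral => x _; rewrite /dotF /reF /imF.
by case: (f x) => a b; case: (g x) => c d /=; ring.
Qed.

Lemma re_innerC f g : re_inner f g = re_inner g f.
Proof. by congr sint; apply/funext => x; rewrite /dotF; ring. Qed.

Lemma re_inner_ge0 f : 0 <= re_inner f f.
Proof. by apply: Rintegral_ge0 => x _; exact: dotF_ge0. Qed.

Lemma re_inner_sqB f g : L2 f -> L2 g ->
  re_inner (fun x => f x - g x) (fun x => f x - g x) =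
  re_inner f f - 2 * re_inner f g + re_inner g g.
Proof.
move=> fL gL; rewrite re_innerBl// ?L2B//; last exact: L2B.
by rewrite ![re_inner _ (fun x => _ - _)]re_innerC !re_innerBl// (re_innerC g f); ring.
Qed.

(** A weighted substitute for the Cauchy-Schwarz inequality: expand the square
norm of [f + s g] and of [f - s g]. It suffices both for continuity and for
integrability. *)
Lemma re_inner_AGM f g (s : R) : 0 < s -> L2 f -> L2 g ->
  2 * `|re_inner f g| <= re_inner f f / s + s * re_inner g g.
Proof.
move=> s0 fL gL.
have If := integrable_dotF_diag fL; have Ig := integrable_dotF_diag gL.
have Ifg := integrable_dotF fL gL.
have key (e : R) : e ^+ 2 = s ^+ 2 ->
    0 <= re_inner f f + 2 * e * re_inner f g + s ^+ 2 * re_inner g g.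
  move=> e2.
  have -> : re_inner f f + 2 * e * re_inner f g + s ^+ 2 * re_inner g g =
     sint (fun x => dotF f f x + 2 * e * dotF f g x + s ^+ 2 * dotF g g x).
    rewrite /sint RintegralD//; last 2 first.
      exact: (integrableD measurableT If (integrableZl measurableT (2 * e) Ifg)).
      exact: (integrableZl measurableT (s ^+ 2) Ig).
    rewrite RintegralD//; last exact: (integrableZl measurableT (2 * e) Ifg).
    by rewrite !RintegralZl.
  apply: Rintegral_ge0 => x _; rewrite -e2 /dotF.
  have := sqr_ge0 (reF f x + e * reF g x); have := sqr_ge0 (imF f x + e * imF g x).
  rewrite !sqrrD !exprMn; lra.
rewrite -(ler_pM2r s0) [leRHS]mulrDl divfK ?gt_eqF//.
rewrite -normr_nat -normrM -[X in _ * X]gtr0_norm// -normrM.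
rewrite ler_norml; apply/andP; split.
- by have := key s erefl; lra.
- by have := key (- s) (sqrrN s); lra.
Qed.

(** Take as weight [s], and as radius, [e / (|g|^2 + 1)]. *)
Lemma re_inner_continuous f g (e : R) : 0 < e -> L2 g ->
  exists2 r : R, 0 < r &
    forall h, L2 f -> L2 h -> dist2 h f < r -> `|re_inner h g - re_inner f g| < e.
Proof.
move=> e0 gL; have g0 := re_inner_ge0 g.
pose s := e / (re_inner g g + 1).
have s0 : 0 < s by rewrite divr_gt0// ltr_wpDl.
exists s => // h fL hL; rewrite -re_innerBl// => d.
have dL := L2B hL fL.
have := re_inner_AGM s0 dL gL.
rewrite -norm2_re_inner -/(dist2 h f).
have d0 : 0 <= dist2 h f by rewrite /dist2 /norm2 sqrtr_ge0.
have : dist2 h f ^+ 2 / s < s.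
  by rewrite ltr_pdivrMr// -expr2 ltr_pXn2r// nnegrE ltW.
have : s + s * re_inner g g = e by rewrite /s; field; rewrite gt_eqF// ltr_wpDl.
by lra.
Qed.

(** Rays generate the Borel sets of the line, so a lower semicontinuous function
on [L^2] is Borel. *)
Lemma L2_borel_preimage (phi : (S2 -> Cx) -> R) :
  (forall a, L2_open [set f | a < phi f]) ->
  forall B, measurable B -> L2_borel (phi @^-1` B).
Proof.
move=> phiO B mB.
have sA : sigma_algebra setT (image_set_system setT phi (@L2_borel R)).
  by apply: sigma_algebra_image; exact: smallest_sigma_algebra.
have GB : <<s @RGenOInfty.G R >> B.
  exact: (eq_ind _ (fun M : set (set R) => M B) mB _ (RGenOInfty.measurableE R)).
have : image_set_system setT phi (@L2_borel R) B.
  apply: (smallest_sub sA _ GB) => _ [r ->].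
  apply: sub_sigma_algebra; rewrite setTI.
  by have := phiO r; congr L2_open; apply/seteqP; split => f /=; rewrite in_itv/= andbT.
by rewrite /image_set_system /= setTI.
Qed.

Lemma L2_borel_re_inner g B : L2 g -> measurable B -> L2_borel ((re_inner^~ g) @^-1` B).
Proof.
move=> gL; apply: L2_borel_preimage => a f fL /= af.
have [r r0 H] := @re_inner_continuous f g (re_inner f g - a) (eqbRL (subr_gt0 _ _) af) gL.
exists r => // h hL fh; have := H _ fL hL fh; rewrite ltr_norml => /andP[+ _] /=; lra.
Qed.

(** Lower semicontinuity, from [|h|^2 >= 2 <h, f> - |f|^2]. *)
Lemma L2_borel_norm B : measurable B -> L2_borel ((fun f => norm2 f ^+ 2) @^-1` B).
Proof.
apply: L2_borel_preimage => a f fL /=; rewrite norm2_re_inner => af.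
have e0 : 0 < (re_inner f f - a) / 2 by rewrite divr_gt0// subr_gt0.
have [r r0 H] := @re_inner_continuous f f _ e0 fL.
exists r => // h hL fh; have := H _ fL hL fh; rewrite /= norm2_re_inner ltr_norml => /andP[+ _].
have := re_inner_ge0 (fun x => f x - h x); rewrite re_inner_sqB// (re_innerC h f); lra.
Qed.
End L2Theory.

(** * Adding independent centred noise *)

Section IndependentNoise.
Context d (Omega : measurableType d) (R : realType) (P : probability Omega R).
Variables (X Y : Omega -> R).
Hypotheses (mX : measurable_fun setT X) (mY : measurable_fun setT Y).
Hypothesis indepXY : forall A B : set R, measurable A -> measurable B ->
  P (X @^-1` A `&` Y @^-1` B) = (P (X @^-1` A) * P (Y @^-1` B))%E.
Hypotheses (iY : P.-integrable setT (EFin \o Y)) (Y0 : \int[P]_w Y w = 0).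
Local Open Scope ereal_scope.

Let Xm : {mfun Omega >-> R} := mfun_Sub (mem_set mX).
Let Ym : {mfun Omega >-> R} := mfun_Sub (mem_set mY).
Let mXY : measurable_fun setT (fun w => (X w, Y w)).
Proof. exact/measurable_fun_pairP. Qed.
Let XYm : {mfun Omega >-> (R * R)%type} := mfun_Sub (mem_set mXY).

(** Integrate [(x + Y)^2 >= x^2 + 2 x Y]; the right-hand side has mean
[x^2]. *)
Lemma noise_lower_bound (x : R) :
  (x ^+ 2)%:E <= \int[P]_w ((x + Y w) ^+ 2)%:E.
Proof.
have i1 : P.-integrable setT (EFin \o (fun=> (x ^+ 2)%R)) by exact: finite_measure_integrable_cst.
have i2 : P.-integrable setT (EFin \o (fun w => (2 * x * Y w)%R)) :=
  integrableZl measurableT (2 * x) iY.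
have iL : P.-integrable setT (EFin \o (fun w => (x ^+ 2 + 2 * x * Y w)%R)) :=
  integrableD measurableT i1 i2.
have -> : (x ^+ 2)%:E = \int[P]_w (x ^+ 2 + 2 * x * Y w)%:E.
  rewrite -(fineK (integrable_fin_num measurableT iL)); congr (_%:E).
  transitivity (\int[P]_w (x ^+ 2 + 2 * x * Y w))%R => //.
  rewrite RintegralD// RintegralZl// Y0 mulr0 addr0 Rintegral_cst//=.
  by rewrite probability_setT mulr1.
rewrite integralE; apply: (@le_trans _ _ (\int[P]_w ((fun w => (x ^+ 2 + 2 * x * Y w)%:E)^\+ w))).
  by rewrite geeDl// oppe_le0; exact: integral_ge0.
apply: ge0_le_integral => //.
- exact: (measurable_funepos (measurable_int _ iL)).
- by apply/measurable_EFinP; apply: measurable_funX; exact: measurable_funD.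
- move=> w _; rewrite funeposE -EFin_max lee_fin ge_max sqr_ge0 andbT.
  by have := sqr_ge0 (Y w); rewrite sqrrD; lra.
Qed.

(** Independence says that the joint law agrees with the product of the laws on
rectangles. *)
Lemma joint_law (A : set (R * R)) : measurable A ->
  (distribution P Xm \x distribution P Ym) A = distribution P XYm A.
Proof.
apply: product_measure_unique => B C mB mC.
exact: indepXY.
Qed.

(** Fix the value of [X] and integrate over the noise first. Both sides may be
infinite. *)
Lemma integral_sq_add_noise :
  \int[P]_w ((X w) ^+ 2)%:E <= \int[P]_w ((X w + Y w) ^+ 2)%:E.
Proof.
have mq : measurable_fun setT (fun p : R * R => ((p.1 + p.2) ^+ 2)%:E).
  apply/measurable_EFinP; apply: measurable_funX.
  by apply: measurable_funD.
have q0 (p : R * R) : 0 <= ((p.1 + p.2) ^+ 2)%:E by rewrite lee_fin sqr_ge0.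
have ms : measurable_fun setT (fun x : R => (x ^+ 2)%:E).
  by apply/measurable_EFinP; exact: measurable_funX.
have s0 (x : R) : 0 <= (x ^+ 2)%:E by rewrite lee_fin sqr_ge0.
have -> : \int[P]_w ((X w + Y w) ^+ 2)%:E =
    \int[distribution P Xm \x distribution P Ym]_p ((p.1 + p.2) ^+ 2)%:E.
  rewrite (eq_measure_integral (distribution P XYm)); last first.
    by move=> A mA _; exact: joint_law.
  by rewrite ge0_integral_distribution.
have -> : \int[P]_w ((X w) ^+ 2)%:E = \int[distribution P Xm]_x (x ^+ 2)%:E.
  by rewrite ge0_integral_distribution.
rewrite fubini_tonelli1//.
apply: ge0_le_integral => //.
- exact: measurable_fun_fubini_tonelli_F.
- move=> x _; rewrite /fubini_F /= ge0_integral_distribution//=.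
    exact: noise_lower_bound.
  by apply/measurable_EFinP; apply: measurable_funX; exact: measurable_funD.
Qed.
End IndependentNoise.

(** * Increments of the driving process *)

Section LevyIncrements.
Context (R : realType) d (Omega : measurableType d) (P : probability Omega R).
Notation Cx := R[i].
Notation S2 := (sphere R).
Variables (F : R -> set (set Omega)) (hF : complete_filtration P F).
Variables (Q : (S2 -> Cx) -> (S2 -> Cx)) (L : R -> Omega -> S2 -> Cx).
Hypothesis hL : levy_process P F Q L.

(** Measurability for the sub-sigma-algebra [F t], stated on the type that
carries it so that sums and products are available. *)
Definition adapted_at (t : R) (X : Omega -> R) : Prop :=
  measurable_fun [set: g_sigma_algebraType (F t)] (X : g_sigma_algebraType (F t) -> R).

Lemma filt_measurable t : 0 <= t -> <<s F t >> = F t.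
Proof.
move=> t0; apply/seteqP; split; last exact: sub_sigma_algebra.
by apply: smallest_sub => //; exact: filt_sigma hF _ t0.
Qed.

Lemma adapted_preimage t X B : 0 <= t -> adapted_at t X -> measurable B -> F t (X @^-1` B).
Proof.
move=> t0 Xt mB; rewrite -(filt_measurable t0) -[X @^-1` B]setTI.
exact: Xt.
Qed.

Lemma adapted_of_preimage t X : (forall B, measurable B -> F t (X @^-1` B)) -> adapted_at t X.
Proof.
by move=> H _ B mB; rewrite setTI; apply: sub_sigma_algebra; exact: H.
Qed.

Lemma adapted_le s t X : 0 <= s -> s <= t -> adapted_at s X -> adapted_at t X.
Proof.
move=> s0 st Xs; apply: adapted_of_preimage => B mB.
by apply: (filt_mono hF s0 st); exact: adapted_preimage.
Qed.

Lemma adapted_measurable t X : 0 <= t -> adapted_at t X -> measurable_fun setT X.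
Proof.
move=> t0 Xt _ B mB; rewrite setTI.
by apply: (filt_sub hF t0); exact: adapted_preimage.
Qed.

Lemma adapted_re_inner t (U : Omega -> S2 -> Cx) g : L2_random (F t) U -> L2 g ->
  adapted_at t (fun w => re_inner (U w) g).
Proof.
move=> [UL UB] gL; apply: adapted_of_preimage => B mB.
exact: (UB _ (L2_borel_re_inner gL mB)).
Qed.

Lemma levy_L2 t w : 0 <= t -> L2 (L t w).
Proof. by move=> t0; have [] := levy_adapted hL t0. Qed.

Lemma adapted_levy t g : 0 <= t -> L2 g -> adapted_at t (fun w => re_inner (L t w) g).
Proof. by move=> t0 gL; apply: adapted_re_inner => //; exact: (levy_adapted hL). Qed.

(** Dominate by the squared norm, which is integrable by hypothesis and
measurable because it is a Borel function on [L^2]. *)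
Lemma integrable_levy t g : 0 <= t -> L2 g ->
  P.-integrable setT (EFin \o (fun w => re_inner (L t w) g)).
Proof.
move=> t0 gL.
have [LL LB] := levy_adapted hL t0.
have mN : measurable_fun setT (fun w => norm2 (L t w) ^+ 2).
  apply: (adapted_measurable t0); apply: adapted_of_preimage => B mB.
  exact: (LB _ (L2_borel_norm mB)).
have iN : P.-integrable setT (EFin \o (fun w => norm2 (L t w) ^+ 2)).
  apply/integrableP; split; first by apply/measurable_EFinP.
  have := levy_square_integrable hL t0; rewrite unlock.
  congr (_ < _)%E; apply: eq_integral => w _ /=; by rewrite ger0_norm// sqr_ge0.
have iB := integrableD measurableT iN
  (finite_measure_integrable_cst P (re_inner g g) measurableT).
apply: (le_integrable measurableT _ _ iB).
  by apply/measurable_EFinP; exact: (adapted_measurable t0 (adapted_levy t0 gL)).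
move=> w _ /=; rewrite lee_fin [leRHS]ger0_norm; last first.
  by apply: addr_ge0; [exact: sqr_ge0|exact: re_inner_ge0].
rewrite norm2_re_inner; have := re_inner_AGM ltr01 (LL w) gL.
have := re_inner_ge0 (L t w); have := re_inner_ge0 g; have := normr_ge0 (re_inner (L t w) g); lra.
Qed.

Lemma mean_levy t g : 0 <= t -> L2 g -> \int[P]_w re_inner (L t w) g = 0.
Proof.
move=> t0 gL; have [] := levy_mean0 hL t0 gL => + _.
by move=> <-; apply: eq_Rintegral => w _; rewrite re_innerE.
Qed.

Lemma re_inner_increment s t w g : 0 <= s -> 0 <= t -> L2 g ->
  re_inner (increment L s t w) g = re_inner (L t w) g - re_inner (L s w) g.
Proof. by move=> s0 t0 gL; rewrite -re_innerBl//; exact: levy_L2. Qed.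

Lemma adapted_increment s t g : 0 <= s -> s <= t -> L2 g ->
  adapted_at t (fun w => re_inner (increment L s t w) g).
Proof.
move=> s0 st gL; have t0 := le_trans s0 st.
rewrite (_ : (fun w => _) = (fun w => re_inner (L t w) g - re_inner (L s w) g)); last first.
  by apply/funext => w; exact: re_inner_increment.
apply: measurable_funB; first exact: adapted_levy.
by apply: (adapted_le s0 st); exact: adapted_levy.
Qed.

Theorem increment_noise s t g (X : Omega -> R) : 0 <= s -> s <= t -> L2 g ->
  adapted_at s X ->
  (\int[P]_w (X w ^+ 2)%:E <=
   \int[P]_w ((X w + re_inner (increment L s t w) g) ^+ 2)%:E)%E.
Proof.
move=> s0 st gL Xs; have t0 := le_trans s0 st.
have incE : (fun w => re_inner (increment L s t w) g) =
    (fun w => re_inner (L t w) g - re_inner (L s w) g).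
  by apply/funext => w; exact: re_inner_increment.
have It := integrable_levy t0 gL; have Is := integrable_levy s0 gL.
apply: integral_sq_add_noise.
- exact: adapted_measurable Xs.
- exact: adapted_measurable (adapted_increment s0 st gL).
- move=> A B mA mB; have FA := adapted_preimage s0 Xs mA.
  exact: (levy_independent hL s0 st FA (L2_borel_re_inner gL mB)).
- rewrite incE; exact: (integrableB measurableT It Is).
- by rewrite incE RintegralB// !mean_levy// subrr.
Qed.
End LevyIncrements.

(** * The exponential rate *)

Section ExpBound.
Context (R : realType).

(** By convexity it suffices to look at the ends of the interval. At [25/8] one
has [exp(1/16) <= 1 / (1 - 1/16) = 16/15], and [(16/15)^50 <= 26]. *)
Lemma expR_le_chord (x : R) : 0 <= x -> x <= 25 / 8 -> expR x <= 1 + 8 * x.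
Proof.
move=> x0 xc.
have e16 : expR (1 / 16) <= 16 / 15 :> R.
  have := expR_ge1Dx (- (1 / 16) : R); rewrite expRN => h.
  have e0 := expR_gt0 (1 / 16 : R).
  have : 15 / 16 <= (expR (1 / 16))^-1 :> R by apply: le_trans h; lra.
  rewrite -ler_pV2 ?inE ?unitfE ?gt_eqF ?invr_gt0//; last by lra.
  by rewrite invrK => /le_trans; apply; lra.
have e5 : (16 / 15) ^+ 5 <= 1381 / 1000 :> R by rewrite !exprS expr0; lra.
have e10 : (1381 / 1000) ^+ 2 <= 1908 / 1000 :> R by rewrite !exprS expr0; lra.
have e50 : (1908 / 1000) ^+ 5 <= 26 :> R by rewrite !exprS expr0; lra.
have ec : expR (25 / 8) <= 26 :> R.
  have -> : 25 / 8 = 50%:R * (1 / 16) :> R by lra.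
  have pw n (a b c : R) : 0 <= a -> a <= b -> b ^+ n <= c -> a ^+ n <= c.
    move=> a0 ab; apply: le_trans; apply: lerXn2r => //; rewrite nnegrE.
    exact: le_trans ab.
  rewrite expRM_natl (_ : 50 = 5 * 2 * 5)%N// !exprM.
  have ge0 := expR_ge0 (1 / 16 : R).
  apply: (pw _ _ _ _ _ _ e50); first by do 2 apply: exprn_ge0.
  apply: (pw _ _ _ _ _ _ e10); first exact: exprn_ge0.
  exact: (pw _ _ _ _ ge0 e16 e5).
have s0 : 0 <= x / (25 / 8) by rewrite divr_ge0.
have s1 : x / (25 / 8) <= 1 by rewrite ler_pdivrMr ?mul1r// ; lra.
have := convex_expR (Itv01 s0 s1) (25 / 8) 0.
rewrite !convRE/= /unstable.onem !mulr0 addr0 expR0 mulr1 divfK; last by rewrite gt_eqF//; lra.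
move=> /le_trans; apply.
have : x / (25 / 8) * expR (25 / 8) <= x / (25 / 8) * 26 by rewrite ler_wpM2l.
by lra.
Qed.

(** [expR_le_chord] at [tau^2 / 2], which is at most [25/8]. *)
Lemma expR_growth (tau : R) n : 0 < tau -> tau <= 5 / 2 ->
  expR (2^-1 * tau * (n%:R * tau)) <= (1 + 4 * tau ^+ 2) ^+ n.
Proof.
move=> t0 t1.
have -> : 2^-1 * tau * (n%:R * tau) = n%:R * (tau ^+ 2 / 2) by field.
rewrite expRM_natl; apply: lerXn2r; rewrite ?nnegrE ?expR_ge0//.
  by rewrite addr_ge0// mulr_ge0// sqr_ge0.
have := @expR_le_chord (tau ^+ 2 / 2); rewrite (_ : 8 * _ = 4 * tau ^+ 2); last by lra.
apply; first by rewrite divr_ge0// sqr_ge0.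
have : tau ^+ 2 <= (5 / 2) ^+ 2 by apply: lerXn2r; rewrite ?nnegrE; lra.
by rewrite [(5 / 2) ^+ 2]expr2; lra.
Qed.
End ExpBound.

(** * Coefficients as inner products *)

Section Functionals.
Context (R : realType) (kappa : nat).
Notation Cx := R[i].
Notation S2 := (sphere R).
Notation idx := (harm_index kappa).
Notation Yb := (@harm R kappa).
Implicit Types (g : S2 -> R) (u : S2 -> Cx).

Lemma L2_spol n m g h : spol n g -> spol m h -> L2 (fun x => g x +i* h x).
Proof.
move=> gn hm; split; [exact: measurable_spol gn|exact: measurable_spol hm|].
have /integrableP[_] := integrable_spol (spolD (spol_le (leq_addr _ _) (spolM gn gn))
  (spol_le (leq_addl _ _) (spolM hm hm))).
congr (_ < _)%E; apply: eq_integral => x _.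
by rewrite /= sqr_sqrtr ?addr_ge0 ?sqr_ge0// ger0_norm ?addr_ge0 -?expr2 ?sqr_ge0.
Qed.

(** Real and imaginary parts of coefficients are values of the real inner
product at the functions [g] and [i g]. *)
Definition re_test (g : S2 -> R) : S2 -> Cx := fun x => g x +i* 0.
Definition im_test (g : S2 -> R) : S2 -> Cx := fun x => 0 +i* g x.

Lemma L2_re_test n g : spol n g -> L2 (re_test g).
Proof. by move=> gn; exact: L2_spol gn (spol_cst 0 0). Qed.
Lemma L2_im_test n g : spol n g -> L2 (im_test g).
Proof. by move=> gn; exact: L2_spol (spol_cst 0 0) gn. Qed.

Lemma re_inner_re_test u g : re_inner u (re_test g) = sint (fun x => reF u x * g x).
Proof. by congr sint; apply/funext => x; rewrite /dotF /reF /imF /= mulr0 addr0. Qed.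
Lemma re_inner_im_test u g : re_inner u (im_test g) = sint (fun x => imF u x * g x).
Proof. by congr sint; apply/funext => x; rewrite /dotF /reF /imF /= mulr0 add0r. Qed.

Lemma re_inner_re_test_expansion u (c : idx -> R) : L2 u ->
  re_inner u (re_test (expansion c)) = \sum_p c p * rcoef (reF u) p.
Proof.
move=> uL; rewrite re_inner_re_test.
transitivity (sint (fun x => \sum_p c p * dotF u (re_test (Yb p)) x)).
  congr sint; apply/funext => x; rewrite mulr_sumr; apply: eq_bigr => p _.
  by rewrite /dotF /reF /imF /= mulr0 addr0; ring.
rewrite sint_sum_integrable; last first.
  by move=> p; apply: integrable_dotF => //; exact: L2_re_test (spol_harm R p).
by apply: eq_bigr => p _; rewrite -/(re_inner u (re_test (Yb p))) re_inner_re_test.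
Qed.

Lemma re_inner_im_test_expansion u (c : idx -> R) : L2 u ->
  re_inner u (im_test (expansion c)) = \sum_p c p * rcoef (imF u) p.
Proof.
move=> uL; rewrite re_inner_im_test.
transitivity (sint (fun x => \sum_p c p * dotF u (im_test (Yb p)) x)).
  congr sint; apply/funext => x; rewrite mulr_sumr; apply: eq_bigr => p _.
  by rewrite /dotF /reF /imF /= mulr0 add0r; ring.
rewrite sint_sum_integrable; last first.
  by move=> p; apply: integrable_dotF => //; exact: L2_im_test (spol_harm R p).
by apply: eq_bigr => p _; rewrite -/(re_inner u (im_test (Yb p))) re_inner_im_test.
Qed.
End Functionals.

(** * The Euler-Maruyama scheme in coefficients *)

Section Scheme.
Context (R : realType) d (Omega : measurableType d) (P : probability Omega R).
Notation Cx := R[i].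
Notation S2 := (sphere R).
Variables (F : R -> set (set Omega)) (hF : complete_filtration P F).
Variables (u0 : Omega -> S2 -> Cx) (hu0 : L2_random (F 0) u0).
Variables (Q : (S2 -> Cx) -> (S2 -> Cx)) (L : R -> Omega -> S2 -> Cx).
Hypothesis hL : levy_process P F Q L.
Variables (tau : R) (tau_gt0 : 0 < tau) (kappa : nat).
Notation idx := (harm_index kappa).
Notation Yb := (@harm R kappa).
Notation u := (euler_maruyama L u0 tau kappa).
Notation inc n := (increment L (n%:R * tau) (n.+1%:R * tau)).

Let tn_ge0 n : 0 <= n%:R * tau. Proof. by rewrite mulr_ge0// ltW. Qed.
Let tn_le n : n%:R * tau <= n.+1%:R * tau.
Proof. by rewrite ler_pM2r// ler_nat. Qed.

Definition re_update (a b : idx -> R) p : R := a p - tau * lambda R (harm_deg p) * b p.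
Definition im_update (a b : idx -> R) p : R := b p + tau * lambda R (harm_deg p) * a p.

(** Real and imaginary parts of the coefficients of the numerical solution.
Multiplication of the noise by [- i] exchanges the two parts of its
coefficients. *)
Fixpoint em_coef n (w : Omega) : (idx -> R) * (idx -> R) :=
  if n is k.+1 then
    let: (a, b) := em_coef k w in
    (fun p => re_update a b p + rcoef (imF (inc k w)) p,
     fun p => im_update a b p - rcoef (reF (inc k w)) p)
  else (rcoef (reF (u0 w)), rcoef (imF (u0 w))).

Lemma em_expansion n w :
  reF (u n w) = expansion (em_coef n w).1 /\ imF (u n w) = expansion (em_coef n w).2.
Proof.
elim: n => [|n [IHr IHi]]; first by split; [exact: reF_sph_proj|exact: imF_sph_proj].
rewrite /=; case: (em_coef n w) IHr IHi => a b /= IHr IHi.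
have lr := reF_laplace (u n w); have li := imF_laplace (u n w).
have pr := @reF_sph_proj R kappa (inc n w); have pi := @imF_sph_proj R kappa (inc n w).
rewrite IHr in lr; rewrite IHi in li.
split; apply/funext => x.
- transitivity (reF (u n w) x + tau * imF (laplace_beltrami (u n w)) x
    + imF (sph_proj kappa (inc n w)) x).
    rewrite /reF /imF; case: (u n w x) => c e; case: (laplace_beltrami _ x) => c1 e1.
    by case: (sph_proj _ _ x) => c2 e2 /=; ring.
  rewrite IHr li pi rlap_expansion /expansion mulr_sumr -!big_split/=.
  by apply: eq_bigr => p _; rewrite /re_update; ring.
- transitivity (imF (u n w) x - tau * reF (laplace_beltrami (u n w)) x
    - reF (sph_proj kappa (inc n w)) x).
    rewrite /reF /imF; case: (u n w x) => c e; case: (laplace_beltrami _ x) => c1 e1.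
    by case: (sph_proj _ _ x) => c2 e2 /=; ring.
  rewrite IHi lr pr rlap_expansion /expansion mulr_sumr -!sumrB.
  by apply: eq_bigr => p _; rewrite /im_update; ring.
Qed.

(** Up to time [t_n] the scheme has only used [u0] and the process up to
[t_n]. *)
Lemma em_adapted n p :
  adapted_at F (n%:R * tau) (fun w => (em_coef n w).1 p) /\
  adapted_at F (n%:R * tau) (fun w => (em_coef n w).2 p).
Proof.
have YL : L2 (re_test (Yb p)) by exact: L2_re_test (spol_harm R p).
have YI : L2 (im_test (Yb p)) by exact: L2_im_test (spol_harm R p).
elim: n => [|n [IHr IHi]].
  rewrite mul0r; split.
  - rewrite (_ : (fun w => _) = fun w => re_inner (u0 w) (re_test (Yb p))).
      exact: adapted_re_inner.
    by apply/funext => w; rewrite re_inner_re_test.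
  - rewrite (_ : (fun w => _) = fun w => re_inner (u0 w) (im_test (Yb p))).
      exact: adapted_re_inner.
    by apply/funext => w; rewrite re_inner_im_test.
have Ar := adapted_increment hF hL (tn_ge0 n) (tn_le n) YL.
have Ai := adapted_increment hF hL (tn_ge0 n) (tn_le n) YI.
have Hr := adapted_le hF (tn_ge0 n) (tn_le n) IHr.
have Hi := adapted_le hF (tn_ge0 n) (tn_le n) IHi.
split.
- rewrite (_ : (fun w => _) = fun w => (em_coef n w).1 p
      - tau * lambda R (harm_deg p) * (em_coef n w).2 p + re_inner (inc n w) (im_test (Yb p))).
    apply: measurable_funD Ai; apply: measurable_funB Hr _.
    exact: measurable_funM (measurable_cst _) Hi.
  by apply/funext => w /=; case: (em_coef n w) => a b /=; rewrite re_inner_im_test.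
- rewrite (_ : (fun w => _) = fun w => (em_coef n w).2 p
      + tau * lambda R (harm_deg p) * (em_coef n w).1 p - re_inner (inc n w) (re_test (Yb p))).
    apply: measurable_funB Ar; apply: measurable_funD Hi _.
    exact: measurable_funM (measurable_cst _) Hr.
  by apply/funext => w /=; case: (em_coef n w) => a b /=; rewrite re_inner_re_test.
Qed.

Section Growth.
Variables (K : finType) (t : K -> idx -> R).
Hypothesis t_orth : forall p q, harm_deg p != harm_deg q -> \sum_k t k p * t k q = 0.
Hypothesis t0 : forall k p, harm_deg p = 0%N -> t k p = 0.

Definition em_form n w : R := qf t (em_coef n w).1 + qf t (em_coef n w).2.

Lemma adapted_lin s (c : idx -> R) (X : Omega -> idx -> R) :
  (forall p, adapted_at F s (X ^~ p)) ->
  adapted_at F s (fun w => \sum_p c p * X w p).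
Proof.
move=> HX; rewrite /index_enum; elim: (Finite.enum _) => [|p r IH].
  by under eq_fun do rewrite big_nil; exact: measurable_cst.
under eq_fun do rewrite big_cons.
by apply: measurable_funD IH; apply: measurable_funM (HX p); exact: measurable_cst.
Qed.

Lemma measurable_qf s (X : Omega -> idx -> R) : 0 <= s ->
  (forall p, adapted_at F s (X ^~ p)) -> measurable_fun setT (fun w => qf t (X w)).
Proof.
move=> s0 HX; rewrite /qf /index_enum; elim: (Finite.enum _) => [|k r IH].
  by under eq_fun do rewrite big_nil; exact: measurable_cst.
under eq_fun do rewrite big_cons.
apply: measurable_funD IH; apply: measurable_funX.
exact: (adapted_measurable hF s0 (adapted_lin _ HX)).
Qed.

Lemma measurable_em_form n : measurable_fun setT (em_form n).
Proof.
by apply: measurable_funD; apply: (measurable_qf (tn_ge0 n)) => p; have [] := em_adapted n p.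
Qed.

Lemma em_form_ge0 n w : 0 <= em_form n w.
Proof. by rewrite addr_ge0// qf_ge0. Qed.

Lemma qf_noise n (X D : Omega -> idx -> R) (g : K -> S2 -> Cx) :
  (forall p, adapted_at F (n%:R * tau) (X ^~ p)) -> (forall k, L2 (g k)) ->
  (forall k w, \sum_p t k p * D w p = re_inner (inc n w) (g k)) ->
  (\int[P]_w (qf t (X w))%:E <= \int[P]_w (qf t (fun p => X w p + D w p))%:E)%E.
Proof.
move=> HX gL gE; pose T k w := \sum_p t k p * X w p.
have TA k : adapted_at F (n%:R * tau) (T k) by exact: adapted_lin.
have Tm k : measurable_fun setT (T k) := adapted_measurable hF (tn_ge0 n) (TA k).
have gm k : measurable_fun setT (fun w => re_inner (inc n w) (g k)).
  apply: (adapted_measurable hF (tn_ge0 n.+1)).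
  exact: (adapted_increment hF hL (tn_ge0 n) (tn_le n)).
rewrite /qf; under eq_integral do rewrite -sumEFin.
under [leRHS]eq_integral do rewrite -sumEFin.
have E k w : \sum_p t k p * (X w p + D w p) = T k w + re_inner (inc n w) (g k).
  by rewrite -gE -big_split/=; apply: eq_bigr => p _; rewrite mulrDr.
rewrite !ge0_integral_sum//; first apply: lee_sum => k _.
- under [leRHS]eq_integral do rewrite E.
  exact: (increment_noise hF hL (tn_ge0 n) (tn_le n) (gL k) (TA k)).
- move=> k; apply/measurable_EFinP; apply: measurable_funX.
  under eq_fun do rewrite E; exact: measurable_funD.
- by move=> k w _; rewrite lee_fin sqr_ge0.
- by move=> k; apply/measurable_EFinP; apply: measurable_funX; exact: Tm.
- by move=> k w _; rewrite lee_fin sqr_ge0.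
Qed.

(** First drop the noise in each functional, then apply [qf_growth] pointwise. *)
Lemma em_form_step n :
  ((1 + 4 * tau ^+ 2)%:E * \int[P]_w (em_form n w)%:E <= \int[P]_w (em_form n.+1 w)%:E)%E.
Proof.
pose a w := (em_coef n w).1; pose b w := (em_coef n w).2.
have Aa p : adapted_at F (n%:R * tau) (a ^~ p) by have [] := em_adapted n p.
have Ab p : adapted_at F (n%:R * tau) (b ^~ p) by have [] := em_adapted n p.
have Ar p : adapted_at F (n%:R * tau) (fun w => re_update (a w) (b w) p).
  apply: measurable_funB (Aa p) _; exact: measurable_funM (measurable_cst _) (Ab p).
have Ai p : adapted_at F (n%:R * tau) (fun w => im_update (a w) (b w) p).
  apply: measurable_funD (Ab p) _; exact: measurable_funM (measurable_cst _) (Aa p).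
have incL w : L2 (inc n w) by apply: L2B; apply: (levy_L2 hL); exact: tn_ge0.
have c0 : 0 <= 1 + 4 * tau ^+ 2 by rewrite addr_ge0// mulr_ge0// sqr_ge0.
have mr := measurable_qf (tn_ge0 n) Ar; have mi := measurable_qf (tn_ge0 n) Ai.
apply: (@le_trans _ _ (\int[P]_w (qf t (re_update (a w) (b w)) +
    qf t (im_update (a w) (b w)))%:E)%E).
  rewrite -ge0_integralZl//; last 2 first.
    exact/measurable_EFinP/measurable_em_form.
    by move=> w _; rewrite lee_fin em_form_ge0.
  apply: ge0_le_integral => //.
  - by move=> w _; rewrite mule_ge0 ?lee_fin ?em_form_ge0.
  - apply: measurable_funeM; exact/measurable_EFinP/measurable_em_form.
  - by apply/measurable_EFinP; exact: measurable_funD.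
  - by move=> w _; rewrite -EFinM lee_fin; exact: qf_growth.
have ms p : adapted_at F (n.+1%:R * tau) (fun w => (em_coef n.+1 w).1 p).
  by have [] := em_adapted n.+1 p.
have ms2 p : adapted_at F (n.+1%:R * tau) (fun w => (em_coef n.+1 w).2 p).
  by have [] := em_adapted n.+1 p.
under eq_integral do rewrite EFinD.
rewrite /em_form; under [leRHS]eq_integral do rewrite EFinD.
have q0 (c : idx -> R) : (0 <= (qf t c)%:E)%E by rewrite lee_fin qf_ge0.
rewrite !ge0_integralD//.
- apply: leeD.
  + under [leRHS]eq_integral.
      move=> w _; rewrite (_ : (em_coef n.+1 w).1 =
          fun p => re_update (a w) (b w) p + rcoef (imF (inc n w)) p).
        over.
      by rewrite /a /b /=; case: (em_coef n w).
    apply: (qf_noise (g := fun k => im_test (expansion (t k)))) => //.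
      by move=> k; exact: L2_im_test (spol_expansion _).
    by move=> k w; rewrite re_inner_im_test_expansion.
  + under [leRHS]eq_integral.
      move=> w _; rewrite (_ : (em_coef n.+1 w).2 =
          fun p => im_update (a w) (b w) p + - rcoef (reF (inc n w)) p).
        over.
      by rewrite /a /b /=; case: (em_coef n w).
    (* the sign comes from Im(- i z) = - Re z *)
    apply: (qf_noise (g := fun k => re_test (expansion (fun p => - t k p)))) => //.
      by move=> k; exact: L2_re_test (spol_expansion _).
    move=> k w; rewrite re_inner_re_test_expansion//; apply: eq_bigr => p _; ring.
- by apply/measurable_EFinP; exact: (measurable_qf (tn_ge0 n.+1)).
- by apply/measurable_EFinP; exact: (measurable_qf (tn_ge0 n.+1)).
- by apply/measurable_EFinP.
- by apply/measurable_EFinP.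
Qed.

Lemma em_form_growth n : tau <= 5 / 2 ->
  ((expR (2^-1 * tau * (n%:R * tau)))%:E * \int[P]_w (em_form 0 w)%:E <=
   \int[P]_w (em_form n w)%:E)%E.
Proof.
move=> tau_le; have q0 m : (0 <= \int[P]_w (em_form m w)%:E)%E.
  by apply: integral_ge0 => w _; rewrite lee_fin em_form_ge0.
apply: (@le_trans _ _ (((1 + 4 * tau ^+ 2) ^+ n)%:E * \int[P]_w (em_form 0 w)%:E)%E).
  by apply: lee_wpmul2r => //; rewrite lee_fin expR_growth.
have c0 : 0 <= 1 + 4 * tau ^+ 2 by rewrite addr_ge0// mulr_ge0// sqr_ge0.
elim: n => [|n IH]; first by rewrite expr0 mul1e.
apply: le_trans (em_form_step n); rewrite exprS EFinM -muleA.
by apply: lee_wpmul2l.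
Qed.
End Growth.

Definition mass_functional (k p : idx) : R := ((k == p) && (0 < harm_deg p)%N)%:R.

Lemma qf_mass (a : idx -> R) : qf mass_functional a = \sum_(p | harm_deg p != 0%N) a p ^+ 2.
Proof.
rewrite /qf [RHS]big_mkcond; apply: eq_bigr => k _.
rewrite (bigD1 k)//= big1 ?addr0 => [|p pk].
  by rewrite /mass_functional eqxx lt0n; case: eqP; rewrite /= ?mul0r ?mul1r ?expr0n.
by rewrite /mass_functional eq_sym (negbTE pk) mul0r.
Qed.

Lemma mass_functional_orth p q : harm_deg p != harm_deg q ->
  \sum_k mass_functional k p * mass_functional k q = 0.
Proof.
move=> pq; apply: big1 => k _; rewrite /mass_functional.
have [->|_] := eqVneq k p; last by rewrite mul0r.
by have [pqE|_] := eqVneq p q; [rewrite pqE eqxx in pq|rewrite mulr0].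
Qed.

Lemma mass_functional0 k p : harm_deg p = 0%N -> mass_functional k p = 0.
Proof. by move=> p0; rewrite /mass_functional p0 andbF. Qed.

Definition energy_functional (k : 'I_3 * idx) (p : idx) : R := gradcoef R k.1 k.2 p.

Lemma energy_functional_orth p q : harm_deg p != harm_deg q ->
  \sum_k energy_functional k p * energy_functional k q = 0.
Proof.
move=> pq; rewrite -(pair_big xpredT xpredT
  (fun j r => gradcoef R j r p * gradcoef R j r q)) /=.
exact: gradcoef_orth.
Qed.

Lemma energy_functional0 k p : harm_deg p = 0%N -> energy_functional k p = 0.
Proof.
move=> p0; rewrite /energy_functional /gradcoef.
have [c _ cE] := sph_harm00 R.
have -> : Yb p = fun=> c.
  rewrite -cE /harm p0; congr sph_harm.
  by have := harm_ord_le p; rewrite p0; case: (harm_ord p) => -[].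
rewrite rgrad_cstE /rcoef; under [X in sint X]eq_fun do rewrite mul0r.
exact: sint0.
Qed.

Lemma qf_energy (a : idx -> R) : qf energy_functional a =
  \sum_(j < 3) \sum_(q : idx) rcoef (rgrad j (expansion a)) q ^+ 2.
Proof.
rewrite pair_big /=; apply: eq_bigr => -[j q] _ /=.
by rewrite rcoef_rgrad_expansion; congr (_ ^+ 2); apply: eq_bigr => p _; exact: mulrC.
Qed.

Lemma em_mass n w : mass (u n w) = mass_mode (u n w) 0 0 + em_form mass_functional n w.
Proof.
have [ur ui] := em_expansion n w.
rewrite (mass_expansion ur ui) (mass_mode00 ur ui) /em_form !qf_mass -big_split/=.
by rewrite (bigID (fun p : idx => harm_deg p == 0%N)).
Qed.

Lemma em_energy n w : energy kappa (u n w) = em_form energy_functional n w.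
Proof.
have [ur ui] := em_expansion n w.
rewrite energyE ur ui /em_form !qf_energy -big_split/=; apply: eq_bigr => j _.
by rewrite -big_split.
Qed.

Lemma measurable_em_mass n : measurable_fun setT (fun w => mass (u n w)).
Proof.
rewrite (_ : (fun w => _) =
    fun w => \sum_p ((em_coef n w).1 p ^+ 2 + (em_coef n w).2 p ^+ 2)); last first.
  by apply/funext => w; have [ur ui] := em_expansion n w; exact: mass_expansion.
apply: measurable_sum => p; have [Ar Ai] := em_adapted n p.
by apply: measurable_funD; apply: measurable_funX; exact: (adapted_measurable hF (tn_ge0 n)).
Qed.
End Scheme.

Theorem proposition11 (R : realType) (d : measure_display)
    (Omega : measurableType d) (P : probability Omega R)
    (F : R -> set (set Omega)) (hF : complete_filtration P F)
    (u0 : Omega -> sphere R -> R[i]) (hu0 : L2_random (F 0) u0)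
    (Q : (sphere R -> R[i]) -> (sphere R -> R[i]))
    (hQ : covariance_operator Q) (trQ : trace_class Q)
    (L : R -> Omega -> sphere R -> R[i]) (hL : levy_process P F Q L)
    (tau : R) (tau_gt0 : 0 < tau) (tau_le : tau <= 5 / 2)
    (kappa : nat) (kappa_gt0 : (0 < kappa)%N) :
  let u := euler_maruyama L u0 tau kappa in
  let M n w := mass (u n w) in
  let M00 n w := mass_mode (u n w) 0 0 in
  let E n w := energy kappa (u n w) in
  let E00 n w := energy_mode kappa (u n w) 0 0 in
  ((0 < 'E_P[fun w => (M 0%N w - M00 0%N w)%R])%E ->
   ('E_P[fun w => (M 0%N w - M00 0%N w)%R] < +oo)%E ->
   ('E_P[M00 0%N] < +oo)%E ->
   forall n : nat,
     ((expR (2^-1 * tau * (n%:R * tau)))%:E *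
        'E_P[fun w => (M 0%N w - M00 0%N w)%R] <= 'E_P[M n])%E)
  /\
  ({ae P, forall w, H1 (u0 w)} ->
   (0 < 'E_P[fun w => (E 0%N w - E00 0%N w)%R])%E ->
   ('E_P[fun w => (E 0%N w - E00 0%N w)%R] < +oo)%E ->
   ('E_P[E00 0%N] < +oo)%E ->
   forall n : nat,
     ((expR (2^-1 * tau * (n%:R * tau)))%:E *
        'E_P[fun w => (E 0%N w - E00 0%N w)%R] <= 'E_P[E n])%E).
Proof.
move=> u M M00 E E00.
split=> [_ _ _ n|_ _ _ _ n].
- have e0 : (fun w => M 0%N w - M00 0%N w) = em_form u0 L tau (@mass_functional R kappa) 0.
    by apply/funext => w; rewrite /M /M00 /u em_mass addrC addKr.
  rewrite e0 unlock.
  apply: le_trans (em_form_growth hF hu0 hL tau_gt0 (@mass_functional_orth R kappa)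
    (@mass_functional0 R kappa) n tau_le) _.
  apply: ge0_le_integral => //.
  + by move=> w _; rewrite lee_fin em_form_ge0.
  + by apply/measurable_EFinP; exact: (measurable_em_form hF hu0 hL).
  + by apply/measurable_EFinP; exact: (measurable_em_mass hF hu0 hL).
  + by move=> w _; rewrite lee_fin /M /u em_mass lerDr sqr_ge0.
- have e0 : (fun w => E 0%N w - E00 0%N w) = em_form u0 L tau (@energy_functional R kappa) 0.
    by apply/funext => w; rewrite /E /E00 energy_mode00 subr0 /u em_energy.
  have en : E n = em_form u0 L tau (@energy_functional R kappa) n.
    by apply/funext => w; rewrite /E /u em_energy.
  rewrite e0 en unlock.
  exact: (em_form_growth hF hu0 hL tau_gt0 (@energy_functional_orth R kappa)
    (@energy_functional0 R kappa) n tau_le).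
Qed.
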